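(* Let $H$ and $H'$ be cubic graphs, each on at least $6$ vertices, where $H$ is non-hamiltonian and $H'$ is hypohamiltonian. Let $ab, cd \in E(H)$ be independent edges and put $J = H - \{ab, cd\}$. Suppose that each of $(a,c)$, $(a,d)$, $(b,c)$, $(b,d)$ is good in $J$, that $((a,b),(c,d))$ is good in $J$, and that for each vertex $t \in V(H)$ at least one of $(a,b)$ or $(c,d)$ is good in $H - \{t, ab, cd\}$ (the graph obtained from $H$ by deleting the vertex $t$ and the edges $ab$, $cd$). Let $x,y$ be adjacent vertices of $H'$, let $a',b'$ be the neighbours of $x$ other than $y$, let $c',d'$ be the neighbours of $y$ other than $x$, and put $J' = H' - \{x,y\}$. Then the dot product $$H \cdot H' = \big(V(H) \cup V(J'),\ E(J) \cup E(J') \cup \{aa', bb', cc', dd'\}\big)$$ is a cubic hypohamiltonian graph. Moreover, if $H$ and $H'$ are planar and $ab$ and $cd$ lie on the same facial cycle of a plane embedding of $H$, then the labelling $a',b',c',d'$ can be chosen so that $H \cdot H'$ is planar. Finally, if $g$ and $g'$ are the girths of $H$ and $H'$ respectively, then the girth of $H \cdot H'$ is at least $\min\{g, g'\}$.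
   Context: All graphs are finite, undirected, without loops or multiple edges. A graph is hamiltonian if it has a cycle through all its vertices; a graph $G$ is hypohamiltonian if $G$ is non-hamiltonian but $G - v$ is hamiltonian for every vertex $v$. Two edges are independent if they share no vertex. For a graph $G$ and vertices $v,w,x,y$: the pair $(v,w)$ is good in $G$ if $G$ has a hamiltonian path with end-vertices $v$ and $w$; the pair of pairs $((v,w),(x,y))$ is good in $G$ if there are two vertex-disjoint paths which together span (cover all vertices of) $G$, one with end-vertices $v$ and $w$ and the other with end-vertices $x$ and $y$. The girth of a graph is the length of its shortest cycle. *)

(* Defs.v *)
From mathcomp Require Import all_boot.
Set Implicit Arguments. Unset Strict Implicit. Unset Printing Implicit Defensive.

Section Graphs.
Variable T : finType.
Implicit Types (e : rel T) (S : {set T}).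

Definition simple_graph e := symmetric e /\ irreflexive e.

Definition nbhd e v : {set T} := [set u | e v u].

Definition cubic e := forall v, #|nbhd e v| = 3.

Definition same_edge (u v a b : T) := ((u == a) && (v == b)) || ((u == b) && (v == a)).

Definition del2 e (a b c d : T) : rel T :=
  fun u v => [&& e u v, ~~ same_edge u v a b & ~~ same_edge u v c d].

Definition ham_cycle_on e S (s : seq T) :=
  [/\ uniq s, (forall v, (v \in s) = (v \in S)), 3 <= size s & cycle e s].
Definition hamiltonian_on e S := exists s, ham_cycle_on e S s.
Definition hamiltonian e := hamiltonian_on e [set: T].
Definition hypohamiltonian e :=
  ~ hamiltonian e /\ forall v, hamiltonian_on e [set~ v].

Definition good_pair e S (v w : T) :=
  exists s, [/\ path e v s, last v s = w, uniq (v :: s)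
              & forall u, (u \in v :: s) = (u \in S)].

Definition good_pairs e S (v w x y : T) :=
  exists s1 s2, [/\ path e v s1, last v s1 = w, path e x s2, last x s2 = y
                 & uniq ((v :: s1) ++ (x :: s2)) /\ forall u, (u \in (v :: s1) ++ (x :: s2)) = (u \in S)].

Definition is_cycle e (s : seq T) := [&& uniq s, 3 <= size s & cycle e s].
Definition is_girth e (g : nat) :=
  (exists s, is_cycle e s /\ size s = g) /\ forall s, is_cycle e s -> g <= size s.

(* Plane embeddings as combinatorial maps (rotation systems): rho v is a
   cyclic permutation of the neighbourhood of v; faces are the orbits of
   the face permutation (u,v) |-> (v, rho v u) on darts; the embedding is
   plane iff every component has Euler genus 0, i.e. (summing Euler's
   formula V - E + F = 2 over components, an isolated vertex counting as
   one face)  V - E + F + #isolated = 2 * #components. *)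
Definition darts e : {set T * T} := [set p | e p.1 p.2].

Definition rotation_system e (rho : T -> T -> T) :=
  forall v,
    [/\ (forall u, u \in nbhd e v -> rho v u \in nbhd e v),
        {in nbhd e v &, injective (rho v)}
      & (forall u w, u \in nbhd e v -> w \in nbhd e v ->
           exists k, iter k (rho v) u = w)].

Definition face_perm (rho : T -> T -> T) (p : T * T) : T * T := (p.2, rho p.2 p.1).
Definition face_of (rho : T -> T -> T) (p : T * T) : {set T * T} :=
  [set q | fconnect (face_perm rho) p q].
Definition faces e rho : {set {set T * T}} := [set face_of rho p | p in darts e].
Definition components e : {set {set T}} := [set [set v | connect e u v] | u : T].
Definition isolated e : {set T} := [set v | nbhd e v == set0].

Definition plane_rotation e rho :=
  rotation_system e rho /\
  2 * (#|T| + #|faces e rho| + #|isolated e|) = #|darts e| + 4 * #|components e|.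

Definition planar e := exists rho, plane_rotation e rho.

End Graphs.

Definition dotV (T T' : finType) (x y : T') : finType :=
  (T + {v : T' | (v != x) && (v != y)})%type.

Definition dot_attach (T T' : finType) (a b c d : T) (a' b' c' d' : T') (u : T) (v : T') :=
  [|| (u == a) && (v == a'), (u == b) && (v == b'),
      (u == c) && (v == c') | (u == d) && (v == d')].

Definition dot (T T' : finType) (H : rel T) (H' : rel T') (a b c d : T)
    (x y a' b' c' d' : T') : rel (dotV T x y) :=
  fun p q =>
    match p, q with
    | inl u, inl v => del2 H a b c d u v
    | inr u, inr v => H' (val u) (val v)
    | inl u, inr v => dot_attach a b c d a' b' c' d' u (val v)
    | inr u, inl v => dot_attach a b c d a' b' c' d' v (val u)
    end.

Arguments dot {T T'} H H' a b c d x y a' b' c' d' _ _.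

(* Main.v *)
Require Import Defs.
From mathcomp Require Import all_boot perm zify.
Set Implicit Arguments. Unset Strict Implicit. Unset Printing Implicit Defensive.

(** The four edges [aa'], [bb'], [cc'], [dd'] separate the dot product, so a
    hamiltonian cycle consists of one or two spanning paths on each side.  A
    single path in [J] from [a] to [b] (or [c] to [d]) closes up to a hamiltonian
    cycle of [H], and otherwise the path in [J'] closes up through [x] and [y] to
    one of [H'].  For two paths it is the other way round: unless those in [J]
    join [a] to [b] and [c] to [d], they close up along [ab] and [cd].
    Conversely, cutting a hamiltonian cycle of [H' - v] at [x] and [y] leaves paths that the
    good pairs of [H] complete.  A short cycle of the dot product lies in [H], or
    in [H'], or its part in [J'] closes up through [x] and [y].

    For planarity the rotations of [H] and [H'] are glued.  By Euler's inequality
    for connected maps it is enough to bound the number of faces from below by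
    [f + f' - 3].  The new face permutation is the disjoint union of the two old
    ones multiplied by eleven transpositions, of which seven split a cycle. *)

(** * Walks and hamiltonian cycles *)

(** That [a'], [b'] differ from [c'], [d'] is not assumed: a common neighbour of [x] and [y] would
    give a triangle, and a cubic hypohamiltonian graph has none.

    The number [f + f' - 3] is forced. A connected cubic plane map on [n] vertices has [2f = n + 4],
    and the dot product has [n + n' - 2] vertices. In the surgery seven splits against four
    transpositions that cost at most one cycle each gain at least three cycles, and six of the
    cycles are discarded: the fixed points at the darts leaving [x] or [y]. Connectedness of the dot
    product, required by Euler's inequality, comes from its hypohamiltonicity, so planarity is
    proved last on that basis.

    The surgery is computed for one orientation: the rotation at [x] is [y, a', b'], the one at [y]
    is [x, c', d'], and a common face runs from [a] to [b] and from [c] to [d]. Three neighbours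
    have only two cyclic orders, so exchanging [a'] with [b'] or [c'] with [d'] reaches this
    situation from any other. *)

Section Walks.
Variables (T : eqType) (e : rel T).
Implicit Types (p q : T) (s : seq T).

(** The list contains both ends and is never empty. Thus walks are glued by [++] across an edge, cut
    by splitting the list and reversed by [rev]. *)
Definition walk p q s :=
  if s is z :: s' then [&& z == p, path e z s' & last z s' == q] else false.

Lemma walkP p q s :
  reflect (exists s', [/\ s = p :: s', path e p s' & last p s' = q]) (walk p q s).
Proof.
apply: (iffP idP) => [|[s' [-> /= -> ->]]]; last by rewrite /= !eqxx.
case: s => //= z s' /and3P[/eqP -> P /eqP L]; by exists s'.
Qed.

Lemma walk_cat p q p' q' s s' :
  walk p q s -> e q p' -> walk p' q' s' -> walk p q' (s ++ s').
Proof.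
move=> /walkP[s1 [-> P L]] E /walkP[s2 [-> P' L']]; apply/walkP.
exists (s1 ++ p' :: s2); split=> //; last by rewrite last_cat /= .
by rewrite cat_path /= P L E P'.
Qed.

Lemma walk_split p q s1 s2 : walk p q (s1 ++ s2) -> s1 != [::] -> s2 != [::] ->
  exists q1 p2, [/\ walk p q1 s1, e q1 p2 & walk p2 q s2].
Proof.
case: s1 s2 => // z s1 [|w s2] //= /and3P[zp]; rewrite cat_path last_cat /=.
move=> /and3P[P1 E P2] L _ _; exists (last z s1), w.
by rewrite zp P1 P2 L !eqxx.
Qed.

Lemma walk_rev p q s : symmetric e -> walk p q s -> walk q p (rev s).
Proof.
move=> es /walkP[s1 [-> P <-]]; apply/walkP; exists (rev (belast p s1)).
split; first by rewrite lastI rev_rcons.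
  by rewrite rev_path (eq_path (e' := e)) // => u v; rewrite es.
by case: s1 {P} => //= z s1; rewrite rev_cons last_rcons.
Qed.

Lemma walk_cycle p q s : walk p q s -> e q p -> cycle e s.
Proof. by move=> /walkP[s1 [-> P L]] E /=; rewrite rcons_path P L. Qed.

Lemma cycle_walk s : cycle e s -> s != [::] -> exists p q, walk p q s /\ e q p.
Proof.
case: s => // z s /=; rewrite rcons_path => /andP[P E] _.
by exists z, (last z s); rewrite /= P !eqxx.
Qed.

Lemma walk_headP p q s : walk p q s -> p \in s.
Proof. by move=> /walkP[s1 [-> _ _]]; rewrite mem_head. Qed.

Lemma walk_lastP p q s : walk p q s -> q \in s.
Proof. by move=> /walkP[s1 [-> _ <-]]; rewrite mem_last. Qed.

Lemma walk_loop p s : uniq s -> walk p p s -> s = [:: p].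
Proof.
move=> U /walkP[[|z s1] [? _ L]]; subst s => //.
by move: U; rewrite /= -{1}L /= mem_last.
Qed.

Lemma walk1 p : walk p p [:: p].
Proof. by rewrite /= !eqxx. Qed.

End Walks.

Lemma sub_walk (T : eqType) (e e' : rel T) p q s :
  subrel e e' -> walk e p q s -> walk e' p q s.
Proof.
move=> ee /walkP[s1 [-> P L]]; apply/walkP; exists s1; split=> //.
exact: sub_path P.
Qed.

Lemma walk_map (T1 T2 : eqType) (f : T1 -> T2) (e1 : rel T1) (e2 : rel T2) p q s :
  injective f -> (forall u v, e2 (f u) (f v) = e1 u v) ->
  walk e2 (f p) (f q) (map f s) = walk e1 p q s.
Proof.
move=> fI fE; case: s => //= z s.
rewrite last_map !inj_eq // path_map (eq_path (e' := e1)) //.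
Qed.

Lemma walk_map_ends (T1 T2 : eqType) (f : T1 -> T2) (e2 : rel T2) p q s :
  walk e2 p q (map f s) -> exists p1 q1, p = f p1 /\ q = f q1.
Proof.
case: s => //= z s /and3P[/eqP <- _ /eqP <-]; rewrite last_map.
by exists z, (last z s).
Qed.

Lemma good_pairP (T : finType) (e : rel T) S v w :
  good_pair e S v w <-> exists s, [/\ walk e v w s, uniq s & s =i S].
Proof.
split=> [[s [P L U M]]|[s0 [/walkP[s [-> P L]] U M]]].
  by exists (v :: s); split=> //; apply/walkP; exists s.
by exists s.
Qed.

Lemma good_pairsP (T : finType) (e : rel T) S v w v' w' :
  good_pairs e S v w v' w' <-> exists s1 s2,
    [/\ walk e v w s1, walk e v' w' s2, uniq (s1 ++ s2) & s1 ++ s2 =i S].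
Proof.
split=> [[s1 [s2 [P1 L1 P2 L2 [U M]]]]|[? [? [/walkP[s1 [-> P1 L1]] /walkP[s2 [-> P2 L2]] U M]]]].
  exists (v :: s1), (v' :: s2).
  by split=> //; apply/walkP; [exists s1|exists s2].
by exists s1, s2.
Qed.

Lemma good_pair_sym (T : finType) (e : rel T) S v w :
  symmetric e -> good_pair e S v w -> good_pair e S w v.
Proof.
move=> es /good_pairP[s [W U M]]; apply/good_pairP; exists (rev s).
by split; rewrite ?walk_rev ?rev_uniq // => z; rewrite mem_rev.
Qed.

Lemma good_pairsC (T : finType) (e : rel T) S v w v' w' :
  good_pairs e S v w v' w' -> good_pairs e S v' w' v w.
Proof.
case/good_pairsP=> s1 [s2 [W1 W2 U M]]; apply/good_pairsP; exists s2, s1.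
by split=> // [|z]; [rewrite uniq_catC | rewrite mem_cat orbC -mem_cat].
Qed.

Lemma good_pairs_symr (T : finType) (e : rel T) S v w v' w' :
  symmetric e -> good_pairs e S v w v' w' -> good_pairs e S v w w' v'.
Proof.
move=> es /good_pairsP[s1 [s2 [W1 W2 U M]]]; apply/good_pairsP; exists s1, (rev s2).
have P : perm_eq (s1 ++ rev s2) (s1 ++ s2) by rewrite perm_cat2l perm_rev.
by split; rewrite ?walk_rev ?(perm_uniq P) // => z; rewrite (perm_mem P).
Qed.

Lemma card_seqE (T : finType) (S : {set T}) s : uniq s -> s =i S -> size s = #|S|.
Proof. by move=> U M; rewrite -(card_uniqP U); apply: eq_card. Qed.

Lemma ham_cycle_rot (T : finType) (e : rel T) S n s :
  ham_cycle_on e S s -> ham_cycle_on e S (rot n s).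
Proof.
case=> U M Z C; split; rewrite ?rot_uniq ?size_rot ?rot_cycle //.
by move=> v; rewrite mem_rot.
Qed.

(** The cycle is opened at [z]. The two neighbours of [z] on it are distinct because a cycle has at
    least three vertices. *)
Lemma ham_cycle_at (T : finType) (e : rel T) (S : {set T}) z :
  hamiltonian_on e S -> z \in S -> exists p q r,
    [/\ walk e p q r, e z p, e q z, p != q & uniq (z :: r) /\ z :: r =i S].
Proof.
case=> s hs zS; have zs : z \in s by case: hs => _ -> .
have [i r E] := rot_to zs; have := ham_cycle_rot i hs; rewrite {}E => -[U M Z C].
case: r U M Z C => [|p r] // U M Z; rewrite [cycle _ _]/= rcons_path.
case/and3P=> E P L.
exists p, (last p r), (p :: r); split=> //; first by rewrite /= P !eqxx.
case: r Z U {M P L} => [|w r] //= _ /and3P[_ + _].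
by apply: contraNneq => ->; apply: mem_last.
Qed.

Lemma hamiltonian_seq (V : finType) (e : rel V) s : 6 <= #|V| ->
  uniq s -> (forall v, v \in s) -> cycle e s -> hamiltonian e.
Proof.
move=> V6 Us Ms C; exists s; have M : s =i [set: V] by move=> v; rewrite Ms inE.
by split=> //; rewrite (card_seqE Us M) cardsT (leq_trans _ V6).
Qed.

Lemma uniq_cat_neq (V : eqType) (s1 s2 : seq V) u v :
  uniq (s1 ++ s2) -> u \in s1 -> v \in s2 -> u != v.
Proof.
rewrite cat_uniq => /and3P[_ h _] us vs; apply: contraNneq h => E.
by apply/hasP; exists v => //=; rewrite -E.
Qed.

Lemma cubic_nbrs (T : finType) (e : rel T) v p q r : cubic e ->
  e v p -> e v q -> e v r -> uniq [:: p; q; r] -> forall u, e v u = (u \in [:: p; q; r]).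
Proof.
move=> cub ep eq er U u.
have sub : [set z in [:: p; q; r]] \subset nbhd e v.
  by apply/subsetP=> z; rewrite !inE => /or3P[] /eqP->.
have: [set z in [:: p; q; r]] == nbhd e v.
  by rewrite eqEcard sub cub cardsE (card_uniqP U).
by move/eqP/setP/(_ u); rewrite !inE => <-.
Qed.

(** * Words over a disjoint union and their left and right runs *)

Section LeftsRights.
Variables (A B : eqType).
Implicit Types (s : seq A) (r : seq B) (L : seq (A + B)%type).

Definition lefts L := pmap (fun z : A + B => if z is inl u then Some u else None) L.
Definition rights L := pmap (fun z : A + B => if z is inr u then Some u else None) L.

Lemma lefts_cat L1 L2 : lefts (L1 ++ L2) = lefts L1 ++ lefts L2.
Proof. exact: pmap_cat. Qed.
Lemma rights_cat L1 L2 : rights (L1 ++ L2) = rights L1 ++ rights L2.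
Proof. exact: pmap_cat. Qed.
Lemma lefts_inl s : lefts (map inl s) = s.
Proof. by elim: s => //= u s {2}<-. Qed.
Lemma lefts_inr r : lefts (map inr r) = [::].
Proof. by elim: r. Qed.
Lemma rights_inr r : rights (map inr r) = r.
Proof. by elim: r => //= u s {2}<-. Qed.
Lemma rights_inl s : rights (map inl s) = [::].
Proof. by elim: s. Qed.
Definition lrE := (lefts_cat, rights_cat, lefts_inl, lefts_inr, rights_inl, rights_inr,
  cats0, cat0s).

Lemma mem_lefts u L : (u \in lefts L) = (inl u \in L).
Proof. by elim: L => //= -[v|v] L IH; rewrite !inE IH. Qed.
Lemma mem_rights u L : (u \in rights L) = (inr u \in L).
Proof. by elim: L => //= -[v|v] L IH; rewrite !inE IH. Qed.

Lemma uniq_lr L : uniq L = uniq (lefts L) && uniq (rights L).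
Proof.
elim: L => //= -[v|v] L ->; rewrite /= ?mem_lefts ?mem_rights.
  by rewrite andbA.
by rewrite andbCA.
Qed.

Lemma size_lr L : size L = size (lefts L) + size (rights L).
Proof. by elim: L => //= -[v|v] L -> /=; rewrite ?addnS. Qed.

Lemma all_left L : rights L = [::] -> exists s, L = map inl s.
Proof.
elim: L => [|[v|v] L IH] //=; first by exists [::].
by case/IH=> s ->; exists (v :: s).
Qed.

Lemma all_right L : lefts L = [::] -> exists r, L = map inr r.
Proof.
elim: L => [|[v|v] L IH] //=; first by exists [::].
by case/IH=> s ->; exists (v :: s).
Qed.

(** A cyclic word cut where it passes from right to left: every run is then complete, and the step
    that closes the cycle is a crossing edge. *)
Definition lr_word L :=
  if L is inl u :: L' then if last (inl u) L' is inr _ then true else false else false.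

Lemma lr_word_rcons u L v : lr_word (inl u :: rcons L (inr v)).
Proof. by rewrite /= last_rcons. Qed.

Lemma lr_wordP L : lr_word L -> exists u L' v, L = inl u :: rcons L' (inr v).
Proof.
case: L => [|[u|//] L] //; case/lastP: L => [|L [v|v]] //.
  by rewrite /= last_rcons.
by exists u, L, v.
Qed.

(** The first rotation brings a left letter to the front. The second moves the trailing left letters
    before it, so that the word ends on the right. *)
Lemma lr_word_rot L : lefts L != [::] -> rights L != [::] -> exists m n, lr_word (rot n (rot m L)).
Proof.
move=> l0 r0; have [u uL] : exists u, inl u \in L.
  case E: (lefts L) l0 => [|u l] // _; exists u.
  by rewrite -mem_lefts E mem_head.
have [i L' EL] := rot_to uL.
have [v vL'] : exists v, inr v \in L'.
  case E: (rights L) r0 => [|v l] // _; exists v.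
  have: inr v \in rot i L by rewrite mem_rot -mem_rights E mem_head.
  by rewrite EL inE.
suff [s0 [M [EM w]]] : exists s0 M, inl u :: L' = M ++ map inl s0 /\ lr_word M.
  exists i, (size M); rewrite EL EM rot_size_cat.
  case: s0 {EM} => // z s0 /=; case/lr_wordP: w => u' [L1 [v' ->]].
  by rewrite -rcons_cons -rcons_cat last_rcons.
elim/last_ind: L' {EL} vL' => // L1 z IH; rewrite mem_rcons inE.
case: z => [z|z] /=.
  case/IH=> s0 [M [E w]]; exists (rcons s0 z), M; split=> //.
  by rewrite -rcons_cons E map_rcons rcons_cat.
by move=> _; exists [::], (inl u :: rcons L1 (inr z)); rewrite cats0 lr_word_rcons.
Qed.

Lemma lr_word_cut L : lr_word L -> exists s r L2,
  [/\ L = map inl s ++ map inr r ++ L2, s != [::], r != [::] & (L2 == [::]) || lr_word L2].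
Proof.
have cutl (M : seq (A + B)) : exists s M', M = map inl s ++ M' /\ if M' is inl _ :: _ then false else true.
  elim: M => [|[u|v] M [s [M' [E h]]]]; first by exists [::], [::].
    by exists (u :: s), M'; rewrite E.
  by exists [::], (inr v :: M).
have cutr (M : seq (A + B)) : exists r M', M = map inr r ++ M' /\ if M' is inr _ :: _ then false else true.
  elim: M => [|[u|v] M [r [M' [E h]]]]; first by exists [::], [::].
    by exists [::], (inl u :: M).
  by exists (v :: r), M'; rewrite E.
have [s [M [E hM]]] := cutl L; have [r [M' [E' hM']]] := cutr M.
case/lr_wordP=> u [L0 [v EL]]; exists s, r, M'; rewrite E E'.
have s0 : s != [::] by apply/eqP=> s0; move: hM; rewrite s0 EL /= in E; rewrite -E.
have lastL z : last z M = inr v \/ M = [::].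
  case: (M) E => [|w M1] E; [by right|left].
  by have := congr1 (last z) E; rewrite EL last_cat /= last_rcons.
split=> //.
  case: (lastL (inl u)) => [lM|M0]; last first.
    have := congr1 (last (inl u)) E; rewrite EL M0 cats0 /= last_rcons.
    by case: (s) => //= z s'; rewrite last_map.
  apply/eqP=> r0; move: E' lM hM hM'; rewrite r0 /= => <-.
  by case: (M) => [|[] ].
case: M' E' hM' => // -[w|w] M' // E' _.
case: (lastL (inl u)) => [|M0]; last by rewrite M0 in E'; case: (r) E'.
by rewrite E' last_cat /= => ->.
Qed.

End LeftsRights.

(** * Permutations and Euler's inequality *)

Section PermOrbits.
Variable X : finType.
Implicit Types (p s al : {perm X}).

Lemma porbits_tperm_ge s u v : #|porbits s| <= #|porbits (tperm u v * s)|.+1.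
Proof.
have := porbits_mul_tperm s u v; rewrite /=.
case: (eqVneq u v) => [<-|_]; first by rewrite porbit_id /=; lia.
by case: (_ \notin _); rewrite /=; lia.
Qed.

Lemma porbits_tperm_le s u v : #|porbits (tperm u v * s)| <= #|porbits s|.+1.
Proof. by have := porbits_mul_tperm s u v; rewrite /=; case: (u != v); lia. Qed.

Lemma porbits_tperm_split s u v : u != v -> u \in porbit s v ->
  #|porbits (tperm u v * s)| = #|porbits s|.+1.
Proof. by move=> uv h; have := porbits_mul_tperm s u v; rewrite /= uv h /=; lia. Qed.

Lemma porbits_tperm_merge s u v : u \notin porbit s v ->
  #|porbits s| = #|porbits (tperm u v * s)|.+1.
Proof.
move=> h; have := porbits_mul_tperm s u v; rewrite /= h.
have -> : u != v by apply: contraNneq h => ->; apply: porbit_id.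
by rewrite /=; lia.
Qed.

Lemma porbit_step s z : s z \in porbit s z.
Proof. by have := mem_porbit s 1 z; rewrite expgS expg0 mulg1. Qed.

Lemma permX_iter s n z : (s ^+ n)%g z = iter n s z.
Proof. by elim: n z => [|n IH] z; rewrite ?expg0 ?perm1 // expgSr permM IH. Qed.

Lemma porbit_inv (Y : Type) (f : X -> Y) s u v :
  (forall z, f (s z) = f z) -> u \in porbit s v -> f u = f v.
Proof.
move=> inv /porbitP[n ->]; rewrite permX_iter.
by elim: n => //= n <-.
Qed.

(* Multiply [p] by the transpositions of [al] one at a time: [f] classifies the
   points into connected pieces, and a transposition joining two pieces merges
   two cycles. *)
Lemma genus_inequality p al : involutive al ->
  exists f : X -> {set X}, [/\ forall z, f (p z) = f z, forall z, f (al z) = f z &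
    2 * (#|porbits p| + #|porbits (al * p)|)
      <= #|[set z | al z != z]| + 4 * #|[set f z | z : X]|].
Proof.
have [n] := ubnP #|[set z | al z != z]|; elim: n al => // n IH al Hn alK.
case: (pickP (fun z => al z != z)) => [u alu|al1]; last first.
  have -> : al = 1%g by apply/permP=> z; rewrite perm1; apply/eqP/negbFE/al1.
  exists (porbit p); split; rewrite ?mul1g //.
  - by move=> z; apply/eqP; rewrite eq_porbit_mem porbit_step.
  - by move=> z; rewrite perm1.
  - by rewrite -/(porbits p); lia.
pose t := tperm u (al u); pose al' := (t * al)%g.
have al'E z : al' z = if (z == u) || (z == al u) then z else al z.
  rewrite permM; case: tpermP => [->|->|/eqP/negPf-> /eqP/negPf->] //.
    by rewrite eqxx.
  by rewrite eqxx orbT.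
have al'K : involutive al'.
  move=> z; rewrite [al' z]al'E; case: ifP => h; rewrite al'E ?h //.
  by rewrite -{1}[u](alK u) !(inj_eq perm_inj) orbC h alK.
have alE : al = (t * al')%g by rewrite /al' mulgA tperm2 mul1g.
have cnt : #|[set z | al' z != z]| + 2 <= #|[set z | al z != z]|.
  rewrite addnC -(_ : #|[set u; al u]| = 2); last by rewrite cards2 eq_sym alu.
  rewrite -cardsUI addnC (_ : _ :&: _ = set0) ?cards0.
    apply: subset_leq_card; apply/subsetP=> z; rewrite !inE => /orP[/orP[]/eqP->|].
    - exact: alu.
    - by rewrite alK eq_sym.
    - by rewrite al'E; case: ifP; rewrite ?eqxx.
  by apply/setP=> z; rewrite !inE al'E; case: ifP; rewrite ?eqxx.
have [|f [fp fal' le]] := IH al' _ al'K.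
  by rewrite -ltnS (leq_trans _ Hn) // ltnS -addn1 (leq_trans _ cnt) // leq_add2l.
pose s := (al' * p)%g.
have fs z : f (s z) = f z by rewrite permM fp fal'.
have als : (al * p = t * s)%g by rewrite {1}alE -mulgA.
(* Within one piece the transposition adds at most one orbit, hence at most 2 on the left, paid for
   by the two points that [al] moves and [al'] fixes. Across two pieces it costs an orbit and at
   most one piece: the left drops by 2, the right by at most 4 - 2. *)
rewrite als; case: (eqVneq (f u) (f (al u))) => [fu|fu].
  exists f; split=> // [z|].
    by rewrite alE permM fal' /t; case: tpermP => [->|->|].
  by have := porbits_tperm_le s u (al u); rewrite -/t; move: le cnt; rewrite -/s; lia.
have nu : u \notin porbit s (al u).
  by apply: contraNN fu => /(porbit_inv fs) ->.
exists (fun z => if f z == f u then f (al u) else f z); split.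
- by move=> z; rewrite fp.
- move=> z; have -> : f (al z) = f (t z) by rewrite {1}alE permM fal'.
  rewrite /t; case: tpermP => [->|->|//].
    by rewrite eqxx; case: ifP.
  by rewrite eqxx; case: ifP.
have leI : #|[set f z | z : X]| <=
    #|[set (if f z == f u then f (al u) else f z) | z : X]|.+1.
  rewrite -add1n -(cards1 (f u)); apply: leq_trans (leq_card_setU _ _).1.
  apply: subset_leq_card; apply/subsetP=> A /imsetP[z _ ->]; rewrite !inE.
  case: (eqVneq (f z) (f u)) => //= h; apply/imsetP; exists z => //.
  by rewrite (negPf h).
by have := porbits_tperm_merge nu; rewrite -/t; move: le cnt leI; rewrite -/s; lia.
Qed.

Lemma card_imset_split (Y : finType) (f : X -> Y) (A : {set X}) :
  (forall u v, u \in A -> v \notin A -> f u != f v) ->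
  #|[set f z | z : X]| = #|f @: A| + #|f @: ~: A|.
Proof.
move=> h; rewrite -cardsUI (_ : _ :&: _ = set0) ?cards0 ?addn0.
  rewrite -imsetU setUCr; apply: eq_card => w.
  by apply/imsetP/imsetP => -[z _ ->]; exists z; rewrite ?inE.
apply/setP=> w; rewrite !inE; apply/negbTE/negP=> /andP[/imsetP[u uA ->] /imsetP[v]].
by rewrite inE => vA /eqP; apply/negP/h.
Qed.

Lemma porbit_fixed s z : s z = z -> porbit s z = [set z].
Proof.
move=> h; apply/setP=> w; rewrite inE; apply/porbitP/eqP => [[n ->]|->].
  by rewrite permX_iter; elim: n => //= n ->.
by exists 0; rewrite expg0 perm1.
Qed.

Lemma card_porbit_fixed s (A : {set X}) :
  {in A, forall z, s z = z} -> #|porbit s @: A| = #|A|.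
Proof.
move=> h; rewrite card_in_imset // => u v uA vA.
by rewrite !porbit_fixed ?h // => /set1_inj.
Qed.

Lemma porbits_split s (A : {set X}) :
  (forall z, (s z \in A) = (z \in A)) ->
  #|porbits s| = #|porbit s @: A| + #|porbit s @: ~: A|.
Proof.
move=> h; apply: card_imset_split => u v uA; apply: contraNneq => E.
by rewrite -(porbit_inv (f := fun z => z \in A) h (u := u)) // -eq_porbit_mem E.
Qed.

End PermOrbits.

(** * Rotation systems as permutations of vertex pairs *)

Section FacePerm.
Variables (V : finType) (e : rel V) (rho : V -> V -> V).
Hypotheses (sg : simple_graph e) (rs : rotation_system e rho).

Let es : symmetric e. Proof. by case: sg. Qed.

Lemma rot_nbr v u : e v u -> e v (rho v u).
Proof. by case: (rs v) => h _ _ vu; have := h u; rewrite !inE; apply. Qed.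

(** [rho] is unconstrained off the darts, so [flipf] and [rotf] are made the identity there. They
    become permutations of all pairs, with the non-darts as fixed points that cancel in every
    count. *)
Definition flipf (z : V * V) := if e z.1 z.2 then (z.2, z.1) else z.
Definition rotf (z : V * V) := if e z.1 z.2 then (z.1, rho z.1 z.2) else z.

Lemma flipfK : involutive flipf.
Proof.
by move=> [u v]; rewrite /flipf /=; case h: (e u v); rewrite /= ?h // es h.
Qed.

Lemma rotf_inj : injective rotf.
Proof.
have dart z : e (rotf z).1 (rotf z).2 = e z.1 z.2.
  by rewrite /rotf; case: ifP => // h; rewrite /= rot_nbr.
move=> z w E; have := dart z; rewrite E dart; move: E; rewrite /rotf => + E0; rewrite E0.
case: ifP => // h [E1 E2]; case: z w E1 E2 h E0 => [z1 z2] [w1 w2] /= <- E2 h E0.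
case: (rs z1) => _ inj _; congr (_, _); by apply: inj E2; rewrite inE // E0.
Qed.

Definition flip_perm : {perm V * V} := perm (inv_inj flipfK).
Definition rot_perm : {perm V * V} := perm rotf_inj.
Definition face_permD : {perm V * V} := (flip_perm * rot_perm)%g.

Lemma face_permD_dart z : e z.1 z.2 -> face_permD z = face_perm rho z.
Proof. by move=> h; rewrite permM !permE /flipf h /rotf /= es h. Qed.

Lemma face_permD_out z : ~~ e z.1 z.2 -> face_permD z = z.
Proof. by move=> h; rewrite permM !permE /flipf (negPf h) /rotf (negPf h). Qed.

Lemma face_perm_dart z : e z.1 z.2 -> e (face_perm rho z).1 (face_perm rho z).2.
Proof. by move=> h; rewrite /= rot_nbr // es. Qed.

Lemma face_permD_iter n z : e z.1 z.2 ->
  iter n face_permD z = iter n (face_perm rho) z /\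
  e (iter n face_permD z).1 (iter n face_permD z).2.
Proof.
move=> h; elim: n => //= n [IH IHe]; rewrite face_permD_dart // IH; split=> //.
by apply: face_perm_dart; rewrite -IH.
Qed.

Lemma porbit_face z : e z.1 z.2 -> porbit face_permD z = face_of rho z.
Proof.
move=> h; apply/setP=> w; rewrite inE; apply/porbitP/idP => [[n ->]|/iter_findex <-].
  by rewrite permX_iter (face_permD_iter n h).1 fconnect_iter.
by exists (findex (face_perm rho) z w); rewrite permX_iter (face_permD_iter _ h).1.
Qed.

Lemma card_porbits_face : #|porbits face_permD| = #|faces e rho| + #|~: darts e|.
Proof.
rewrite (porbits_split (A := darts e)) => [|z]; last first.
  rewrite !inE; case h: (e z.1 z.2); last by rewrite face_permD_out ?h.
  by rewrite face_permD_dart // face_perm_dart.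
rewrite [X in _ + X]card_porbit_fixed => [|z]; last by rewrite !inE => /face_permD_out.
suff -> : porbit face_permD @: darts e = faces e rho by [].
by apply: eq_in_imset => z; rewrite inE; apply: porbit_face.
Qed.

Lemma connect_inv (Y : Type) (f : V -> Y) u v :
  (forall u v, e u v -> f u = f v) -> connect e u v -> f u = f v.
Proof.
move=> h /connectP[s P ->]; elim: s u P => //= w s IH u /andP[/h-> /IH]; exact.
Qed.

(** The genus inequality for the rotation and the flip of edges. If [N] pairs are not darts, there
    are at least [#|V| + N] orbits of the rotation, exactly [N] more face orbits than faces, at most
    [#|darts e|] moved points and at most [1 + N] pieces, so [N] cancels. *)
Lemma euler_inequality : (forall v, exists w, e v w) -> (forall u v, connect e u v) ->
  2 * (#|V| + #|faces e rho|) <= #|darts e| + 4.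
Proof.
move=> nb conn.
pose n v := odflt v [pick w | e v w].
have nP v : e v (n v).
  by rewrite /n; case: pickP => //= h; case: (nb v) => w; rewrite h.
case: (pickP (@predT V)) => [v0 _|V0]; last first.
  have D0 : darts e = set0.
    by apply/setP=> -[v w]; have := V0 v.
  have -> : faces e rho = set0 by rewrite /faces D0 imset0.
  by rewrite D0 !cards0 (eq_card0 V0).
have flipK : involutive flip_perm by move=> z; rewrite !permE flipfK.
have [f [fr ff le]] := genus_inequality rot_perm flipK.
have {}fr v u : e v u -> f (v, rho v u) = f (v, u).
  by move=> h; rewrite -[RHS]fr permE /rotf /= h.
have {}ff v u : e v u -> f (u, v) = f (v, u).
  by move=> h; rewrite -[RHS]ff permE /flipf /= h.
have frr v u w : e v u -> e v w -> f (v, u) = f (v, w).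
  move=> vu vw; case: (rs v) => _ _ tr.
  have [k <-] : exists k, iter k (rho v) u = w by apply: tr; rewrite inE.
  suff [] : f (v, u) = f (v, iter k (rho v) u) /\ e v (iter k (rho v) u) by [].
  by elim: k => //= k [IH h]; rewrite fr // rot_nbr.
(* All darts lie in one piece: [frr] moves around a vertex, [ff] moves across an edge, and the graph
   is connected. *)
have fc z : e z.1 z.2 -> f z = f (v0, n v0).
  case: z => v w /= h; rewrite (frr _ _ (n v)) //.
  apply: (connect_inv (f := fun v => f (v, n v))) (conn v v0) => u1 u2 h12.
  have h21 : e u2 u1 by rewrite es.
  by rewrite (frr u1 (n u1) u2) // (frr u2 (n u2) u1) // -(ff _ _ h12).
have leI : #|[set f z | z : V * V]| <= 1 + #|~: darts e|.
  apply: leq_trans (leq_trans (leq_card_setU [set f (v0, n v0)] (f @: ~: darts e)).1 _); last first.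
    by rewrite cards1 leq_add2l leq_imset_card.
  apply: subset_leq_card; apply/subsetP=> A /imsetP[z _ ->]; rewrite !inE.
  case h: (e z.1 z.2); first by rewrite fc ?eqxx.
  by apply/orP; right; apply/imsetP; exists z; rewrite ?inE ?h.
have leF : #|[set z | flip_perm z != z]| <= #|darts e|.
  apply: subset_leq_card; apply/subsetP=> z; rewrite !inE permE /flipf.
  by case: ifP; rewrite ?eqxx.
have leR : #|V| + #|~: darts e| <= #|porbits rot_perm|.
  rewrite (porbits_split (A := darts e)) => [|z]; last first.
    by rewrite !inE permE /rotf; case: ifP => // h; rewrite /= rot_nbr.
  rewrite [X in _ <= _ + X]card_porbit_fixed => [|z]; last first.
    by rewrite !inE permE /rotf => /negPf->.
  rewrite leq_add2r -cardsT -(card_in_imset (f := fun v => porbit rot_perm (v, n v))).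
    apply: subset_leq_card; apply/subsetP=> A /imsetP[v _ ->].
    by apply/imsetP; exists (v, n v); rewrite ?inE ?nP.
  move=> u v _ _ /eqP; rewrite eq_porbit_mem => /(porbit_inv (f := fst)); apply.
  by move=> z; rewrite permE /rotf; case: ifP.
move: le leI leF leR; rewrite -/face_permD card_porbits_face.
by do 7!move: (#|_|) => ?; lia.
Qed.

End FacePerm.

Lemma face_of_trans (V : finType) (e : rel V) rho p q r :
  simple_graph e -> rotation_system e rho -> p \in darts e -> q \in darts e ->
  q \in face_of rho p -> r \in face_of rho p -> r \in face_of rho q.
Proof.
rewrite ![_ \in darts e]inE => sg rs pd qd.
by rewrite -!(porbit_face sg rs) // -eq_porbit_mem => /eqP->.
Qed.

Lemma card_darts (V : finType) (e : rel V) : cubic e -> #|darts e| = 3 * #|V|.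
Proof.
move=> cub; rewrite -sum1_card (eq_bigl (fun p => predT p.1 && e p.1 p.2)).
  rewrite -(pair_big_dep predT (fun v w => e v w) (fun _ _ => 1)) /=.
  rewrite (eq_bigr (fun _ => 3)) => [|v _]; first by rewrite sum_nat_const mulnC.
  by rewrite -(cub v) -sum1_card; apply: eq_bigl => w; rewrite inE.
by move=> p; rewrite inE.
Qed.

Lemma plane_cubicE (V : finType) (e : rel V) rho : cubic e -> 0 < #|V| ->
  (forall u v, connect e u v) ->
  plane_rotation e rho <-> rotation_system e rho /\ 2 * #|faces e rho| = #|V| + 4.
Proof.
move=> cub V0 conn.
have iso : isolated e = set0.
  by apply/setP=> v; rewrite !inE -cards_eq0 cub.
have comp : #|components e| = 1.
  have [v0 _] : exists v0, v0 \in V by apply/card_gt0P.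
  rewrite -(cards1 [set: V]); apply: eq_card => A; rewrite inE.
  have E u : [set v | connect e u v] = [set: V] by apply/setP=> v; rewrite !inE conn.
  by apply/imsetP/eqP => [[u _ ->]|->]; [|exists v0].
rewrite /plane_rotation comp iso cards0 card_darts //.
by split=> -[rs E]; split=> //; move: E; do 2!move: (#|_|) => ?; lia.
Qed.

(** After deletion of a third vertex, [u] and [v] lie on a common cycle. *)
Lemma hypohamiltonian_connected (V : finType) (e : rel V) : 2 < #|V| ->
  hypohamiltonian e -> forall u v, connect e u v.
Proof.
move=> V3 [_ hyp] u v.
have [w wu wv] : exists2 w, w != u & w != v.
  case: (pickP (fun w => (w != u) && (w != v))) => [w /andP[]|h]; first by exists w.
  have : #|V| <= #|[set u; v]|.
    rewrite -cardsT; apply: subset_leq_card; apply/subsetP=> w _; rewrite !inE.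
    by have := h w; rewrite -negb_or => /negbFE.
  by rewrite cards2; case: (u != v); lia.
have [s [_ M _ C]] := hyp w.
by apply: (connect_cycle C); rewrite M !inE eq_sym.
Qed.

Lemma eq_planar (V : finType) (e e' : rel V) : e =2 e' -> planar e -> planar e'.
Proof.
move=> E [rho [rs eul]]; exists rho.
have nbE v : nbhd e v = nbhd e' v by apply/setP=> w; rewrite !inE E.
have dE : darts e = darts e' by apply/setP=> w; rewrite !inE E.
have iE : isolated e = isolated e' by apply/setP=> w; rewrite !inE nbE.
have cE : components e = components e'.
  by apply: eq_imset => u; apply/setP=> w; rewrite !inE (eq_connect E).
split; first by move=> v; rewrite -nbE.
by rewrite /faces -dE -iE -cE.
Qed.

(** Transitivity excludes fixed points and 2-cycles, so only the two cyclic orders remain.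
    Exchanging two labels turns one into the other, and this is where the free choice of labelling
    is spent. *)
Lemma rotation3 (V : finType) (e : rel V) rho v p q r : rotation_system e rho ->
  (forall u, e v u = (u \in [:: p; q; r])) -> uniq [:: p; q; r] ->
  [/\ rho v p = q, rho v q = r & rho v r = p] \/ [/\ rho v p = r, rho v r = q & rho v q = p].
Proof.
move=> rs E; rewrite /= !inE negb_or andbT => /andP[/andP[pq pr] qr].
have [r1 r2 r3] := rs v.
have [ep eq er] : [/\ p \in nbhd e v, q \in nbhd e v & r \in nbhd e v].
  by rewrite !inE !E !inE !eqxx ?orbT.
have fixd u w : u \in nbhd e v -> w \in nbhd e v -> rho v u = u -> w = u.
  move=> eu ew fu; have [k <-] := r3 _ _ eu ew.
  by elim: k => //= k ->.
have cyc2 u1 u2 w : u1 \in nbhd e v -> w \in nbhd e v -> rho v u1 = u2 -> rho v u2 = u1 ->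
    w = u1 \/ w = u2.
  move=> eu ew f1 f2; have [k <-] := r3 _ _ eu ew.
  by elim: k => [|k [] /= ->]; [left|right|left].
have im u : u \in nbhd e v -> [\/ rho v u = p, rho v u = q | rho v u = r].
  move=> /r1; rewrite inE E !inE => /or3P[] /eqP->;
  by [constructor 1|constructor 2|constructor 3].
have inj u w : u \in nbhd e v -> w \in nbhd e v -> u != w -> rho v u != rho v w.
  by move=> eu ew; apply: contraNneq => /(r2 _ _ eu ew)->.
case: (im p ep) => [fp|fp|fp].
- by case/eqP: pq; rewrite (fixd _ _ ep eq fp).
- left; have fq : rho v q = r.
    case: (im q eq) => // fq.
      case: (cyc2 _ _ _ ep er fp fq) => E'; first by rewrite E' eqxx in pr.
      by rewrite E' eqxx in qr.
    by have := inj _ _ ep eq pq; rewrite fp fq eqxx.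
  split=> //; case: (im r er) => // fr.
    by have := inj _ _ ep er pr; rewrite fp fr eqxx.
  by have := inj _ _ eq er qr; rewrite fq fr eqxx.
- right; have fr : rho v r = q.
    case: (im r er) => // fr.
      case: (cyc2 _ _ _ ep eq fp fr) => E'; first by rewrite E' eqxx in pq.
      by rewrite E' eqxx in qr.
    by have := inj _ _ ep er pr; rewrite fp fr eqxx.
  split=> //; case: (im q eq) => // fq.
    by have := inj _ _ eq er qr; rewrite fq fr eqxx.
  by have := inj _ _ ep eq pq; rewrite fp fq eqxx.
Qed.

Section SumPerm.
Variables (A B : finType) (p : {perm A}) (q : {perm B}).

Definition sumf (z : A + B) : A + B :=
  match z with inl u => inl (p u) | inr v => inr (q v) end.

Lemma sumf_inj : injective sumf.
Proof. by move=> [u|u] [v|v] //= [/perm_inj->]. Qed.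

Definition sum_perm : {perm A + B} := perm sumf_inj.

Lemma porbit_suml u : porbit sum_perm (inl u) = inl @: porbit p u.
Proof.
have it n : iter n sum_perm (inl u) = inl (iter n p u).
  by elim: n => //= n ->; rewrite permE.
apply/setP=> w; apply/porbitP/imsetP => [[n ->]|[v /porbitP[n ->] ->]].
  by exists ((p ^+ n)%g u); rewrite ?mem_porbit // !permX_iter it.
by exists n; rewrite !permX_iter it.
Qed.

Lemma porbit_sumr u : porbit sum_perm (inr u) = inr @: porbit q u.
Proof.
have it n : iter n sum_perm (inr u) = inr (iter n q u).
  by elim: n => //= n ->; rewrite permE.
apply/setP=> w; apply/porbitP/imsetP => [[n ->]|[v /porbitP[n ->] ->]].
  by exists ((q ^+ n)%g u); rewrite ?mem_porbit // !permX_iter it.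
by exists n; rewrite !permX_iter it.
Qed.

Lemma card_porbits_sum : #|porbits sum_perm| = #|porbits p| + #|porbits q|.
Proof.
rewrite (porbits_split (A := inl @: [set: A])) => [|z]; last first.
  rewrite permE; case: z => z /=; first by rewrite !imset_f ?inE.
  by apply/imsetP/imsetP => -[].
congr (_ + _).
  rewrite -(card_imset (porbits p) (imset_inj (@inl_inj A B))) -imset_comp /porbits.
  rewrite -imset_comp; apply: eq_card => w; apply/imsetP/imsetP => -[z _ ->]; exists z => //=;
   by rewrite porbit_suml.
rewrite -(card_imset (porbits q) (imset_inj (@inr_inj A B))) /porbits.
rewrite -imset_comp; apply: eq_card => w; apply/imsetP/imsetP => -[z].
  case: z => [z|z]; first by rewrite inE imset_f ?inE.
  by move=> _ ->; exists z => //=; rewrite porbit_sumr.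
move=> _ ->; exists (inr z); last by rewrite /= porbit_sumr.
by rewrite inE; apply/imsetP => -[].
Qed.

End SumPerm.

(** * The dot product *)

(* In [G - q] the vertex [p] keeps only two neighbours, so a hamiltonian cycle
   runs through [p r], and [q] can be inserted between [p] and [r]. *)
Lemma hypohamiltonian_no_triangle (T : finType) (e : rel T) p q r :
  simple_graph e -> cubic e -> hypohamiltonian e -> e p q -> e q r -> e r p -> False.
Proof.
move=> [es ei] cub [nh hyp] pq qr rp.
have neq u v : e u v -> u != v by apply: contraTneq => ->; rewrite ei.
have pS : p \in [set~ q] by rewrite !inE neq.
have [u [v [s [W pu vp uv [U M]]]]] := ham_cycle_at (hyp q) pS.
suff [v' [s' [W' vp' U' M']]] : exists v' s',
    [/\ walk e r v' s', e v' p, uniq (p :: s') & p :: s' =i [set~ q]].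
  apply: nh; exists ([:: p; q] ++ s'); split.
  - move: U' (M' q); rewrite /= !inE eqxx (negPf (neq _ _ pq)) eq_sym (negPf (neq _ _ pq)) /=.
    by move=> /andP[-> ->] ->.
  - move=> z; move: (M' z); rewrite /= !inE orbCA => ->.
    by rewrite orbN.
  - by case: (s') W'.
  - apply: (@walk_cycle _ _ p v' ([:: p; q] ++ s')); last exact: vp'.
    by apply: walk_cat W'; last exact: qr; rewrite /= pq !eqxx.
have uNq : u != q by have := M u; rewrite !inE (walk_headP W) orbT => <-.
have vNq : v != q by have := M v; rewrite !inE (walk_lastP W) orbT => <-.
case: (eqVneq u r) => [ur|uNr]; first by exists v, s; subst u.
suff vr : v = r.
  by exists u, (rev s); rewrite -vr (walk_rev es W) es pu /= !mem_rev rev_uniq; split=> // z;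
     rewrite -M !inE mem_rev.
have E := cubic_nbrs cub pq pu (etrans (es p r) rp).
have : v \in [:: q; u; r].
  rewrite -E ?(es p) //= !inE !negb_or eq_sym uNq uNr andbT.
  by rewrite (neq _ _ qr).
by rewrite !inE (negPf vNq) eq_sym (negPf uv) => /eqP.
Qed.

(** The planarity proof uses several labellings of the same graphs, each an instance of this record.
    The field [ds_uniq'] includes the distinctness that comes from the absence of triangles. *)
Record dot_setup (T T' : finType) (H : rel T) (H' : rel T') (a b c d : T)
    (x y a' b' c' d' : T') : Prop := DotSetup {
  ds_sg : simple_graph H; ds_sg' : simple_graph H';
  ds_cub : cubic H; ds_cub' : cubic H';
  ds_ab : H a b; ds_cd : H c d; ds_uniq : uniq [:: a; b; c; d];
  ds_xy : H' x y; ds_xa : H' x a'; ds_xb : H' x b'; ds_yc : H' y c'; ds_yd : H' y d';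
  ds_uniq' : uniq [:: x; y; a'; b'; c'; d'] }.

(** * Ports, hubs and the neighbourhoods in the dot product *)

Section Dot.
Variables (T T' : finType) (H : rel T) (H' : rel T').
Variables (a b c d : T) (x y a' b' c' d' : T').
Hypothesis DS : dot_setup H H' a b c d x y a' b' c' d'.

Let U := {v : T' | (v != x) && (v != y)}.
Let J := del2 H a b c d.
Let G : rel (T + U)%type := dot H H' a b c d x y a' b' c' d'.

Definition ports := [:: a; b; c; d].
(** For a port [u], [mate u] is the other end of its removed edge, [prt u] its new neighbour, and
    [hub u] the vertex among [x], [y] that [prt u] has lost. Arguments can then be given for one
    port instead of four. Off the ports the values are junk. *)
Definition mate u := if u == a then b else if u == b then a else if u == c then d else c.
Definition prt u := if u == a then a' else if u == b then b' else if u == c then c' else d'.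
Definition hub u := if (u == a) || (u == b) then x else y.

Let symH : symmetric H. Proof. by case: (ds_sg DS). Qed.
Let symH' : symmetric H'. Proof. by case: (ds_sg' DS). Qed.

Let pE : ((a == b) = false) * ((b == a) = false) * ((a == c) = false) * ((c == a) = false) *
  ((a == d) = false) * ((d == a) = false) * ((b == c) = false) * ((c == b) = false) *
  ((b == d) = false) * ((d == b) = false) * ((c == d) = false) * ((d == c) = false).
Proof.
have := ds_uniq DS; rewrite /= !inE !negb_or -!andbA andbT.
case/and5P=> ab ac ad bc /andP[bd cd].
by do !split; apply: negbTE => //; rewrite eq_sym.
Qed.

Let qE : ((a' == b') = false) * ((b' == a') = false) * ((a' == c') = false) * ((c' == a') = false) *
  ((a' == d') = false) * ((d' == a') = false) * ((b' == c') = false) * ((c' == b') = false) *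
  ((b' == d') = false) * ((d' == b') = false) * ((c' == d') = false) * ((d' == c') = false).
Proof.
have := ds_uniq' DS; rewrite /= !inE !negb_or -!andbA andbT.
do 9![case/andP=> _]; case/and5P=> ab ac ad bc /andP[bd cd].
by do !split; apply: negbTE => //; rewrite eq_sym.
Qed.

Let xE : ((x == y) = false) * ((y == x) = false) * ((a' == x) = false) * ((a' == y) = false) *
  ((b' == x) = false) * ((b' == y) = false) * ((c' == x) = false) * ((c' == y) = false) *
  ((d' == x) = false) * ((d' == y) = false).
Proof.
have := ds_uniq' DS; rewrite /= !inE !negb_or -!andbA andbT.
do 9![case/andP=> ?] => _.
by do !split; apply: negbTE => //; rewrite eq_sym.
Qed.

Lemma portsP u : u \in ports -> [\/ u = a, u = b, u = c | u = d].
Proof. by rewrite !inE => /or4P[] /eqP->; [constructor 1|constructor 2|constructor 3|constructor 4]. Qed.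

Lemma mate_port u : mate u \in ports.
Proof. by rewrite /mate !inE; do 3?case: ifP; rewrite !eqxx ?orbT. Qed.

Lemma mateK u : u \in ports -> mate (mate u) = u.
Proof. by case/portsP=> ->; rewrite /mate /=; do ?rewrite !(eqxx, pE, qE, xE) /=. Qed.

Lemma mate_neq u : u \in ports -> mate u != u.
Proof. by case/portsP=> ->; rewrite /mate /=; do ?rewrite !(eqxx, pE, qE, xE) /=. Qed.

Lemma H_mate u : u \in ports -> H u (mate u).
Proof.
case/portsP=> ->; rewrite /mate /=; do ?rewrite !(eqxx, pE, qE, xE) /=.
- exact: (ds_ab DS).
- by rewrite symH (ds_ab DS).
- exact: (ds_cd DS).
- by rewrite symH (ds_cd DS).
Qed.

Lemma del2E u w : J u w = H u w && ~~ ((u \in ports) && (w == mate u)).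
Proof.
rewrite /J /del2 -negb_or; congr (_ && ~~ _); rewrite /same_edge /mate !inE.
case: (eqVneq u a) => [->|ua]; first by rewrite !pE /= !orbF.
case: (eqVneq u b) => [->|ub]; first by rewrite !pE /= !orbF.
case: (eqVneq u c) => [->|uc]; first by rewrite !pE /= !orbF.
by case: (eqVneq u d).
Qed.

Lemma attachE u v :
  dot_attach a b c d a' b' c' d' u v = (u \in ports) && (v == prt u).
Proof.
rewrite /dot_attach /prt !inE.
case: (eqVneq u a) => [->|ua]; first by rewrite !pE /= !orbF.
case: (eqVneq u b) => [->|ub]; first by rewrite !pE /= !orbF.
case: (eqVneq u c) => [->|uc]; first by rewrite !pE /= !orbF.
by case: (eqVneq u d).
Qed.

Lemma prt_inner u : (prt u != x) && (prt u != y).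
Proof. by rewrite /prt; do 3?case: ifP => _; rewrite !xE. Qed.

Definition port u : U := exist (fun v => (v != x) && (v != y)) (prt u) (prt_inner u).

Lemma prt_inj : {in ports &, injective prt}.
Proof.
move=> u w /portsP[] -> /portsP[] ->; rewrite /prt /=; do ?rewrite !(eqxx, pE, qE, xE) /= //;
 by move/eqP; rewrite qE.
Qed.

Lemma hub_prt u : u \in ports -> H' (hub u) (prt u).
Proof.
by case/portsP=> ->; rewrite /hub /prt /=; do ?rewrite !(eqxx, pE, qE, xE) /=; case: DS.
Qed.

Lemma prt_hub u : u \in ports -> H' (prt u) (hub u).
Proof. by move=> pu; rewrite symH' hub_prt. Qed.

Lemma hub_edge u w : hub u != hub w -> H' (hub u) (hub w).
Proof.
by rewrite /hub; do 2?case: ifP => _; rewrite ?eqxx // ?[H' y x]symH' (ds_xy DS).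
Qed.

(** This decides how a path of [J'] between two attachment vertices closes up in [H']: through a
    single hub when the ports are mates, along the edge [x y] otherwise. *)
Lemma hub_eq u w : u \in ports -> w \in ports -> u != w -> (hub u == hub w) = (w == mate u).
Proof.
move=> /portsP[] -> /portsP[] ->; rewrite /hub /mate /=; do ?rewrite !(eqxx, pE, qE, xE) /=;
 by rewrite ?eqxx ?xE ?pE.
Qed.

Lemma hub_mate u : u \in ports -> hub (mate u) = hub u.
Proof.
move=> pu; apply/eqP.
by rewrite eq_sym hub_eq ?mate_port // eq_sym mate_neq.
Qed.

Lemma hub_xy u : (hub u == x) || (hub u == y).
Proof. by rewrite /hub; case: ifP; rewrite eqxx ?orbT. Qed.

Lemma nbr_x v : H' x v = (v \in [:: y; a'; b']).
Proof. by apply: cubic_nbrs; case: DS => //= *; rewrite !inE ?qE ?[y == _]eq_sym ?xE. Qed.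

Lemma nbr_y v : H' y v = (v \in [:: x; c'; d']).
Proof.
by apply: cubic_nbrs; case: DS => //= *; rewrite 1?symH' // !inE ?qE ?[x == _]eq_sym ?xE.
Qed.

Lemma nbr_hub v z : v != x -> v != y -> (z == x) || (z == y) -> H' z v ->
  exists u, [/\ u \in ports, v = prt u & z = hub u].
Proof.
move=> vx vy /orP[] /eqP->; rewrite ?nbr_x ?nbr_y !inE.
  rewrite (negPf vy) /= => /orP[] /eqP->; [exists a|exists b];
  by rewrite /prt /hub ?inE /=; do ?rewrite !(eqxx, pE, qE, xE) /= ?orbT.
rewrite (negPf vx) /= => /orP[] /eqP->; [exists c|exists d];
by rewrite /prt /hub ?inE /=; do ?rewrite !(eqxx, pE, qE, xE) /= ?orbT.
Qed.

Lemma dotLR u v : G (inl u) (inr v) = (u \in ports) && (v == port u).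
Proof. exact: attachE. Qed.

Lemma dotRL u v : G (inr v) (inl u) = (u \in ports) && (v == port u).
Proof. exact: attachE. Qed.

Lemma dotLL u w : G (inl u) (inl w) = J u w. Proof. by []. Qed.
Lemma dotRR (u w : U) : G (inr u) (inr w) = H' (val u) (val w). Proof. by []. Qed.

Lemma dot_sym : symmetric G.
Proof.
move=> [u|u] [w|w]; rewrite ?dotLR ?dotRL // ?dotRR ?(symH' (val u)) // !dotLL /J /del2 symH.
rewrite /same_edge ![(u == _) && _]andbC.
by rewrite [in RHS]orbC; congr [&& _, ~~ _ & ~~ _]; rewrite orbC.
Qed.

Lemma dot_simple : simple_graph G.
Proof.
split; first exact: dot_sym.
case=> u; first by rewrite dotLL /J /del2 (ds_sg DS).2.
by rewrite dotRR (ds_sg' DS).2.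
Qed.

(** A bijection from the neighbours of [u] in [H] to those in the dot product, the attachment vertex
    replacing the lost neighbour [mate u]; [backL] is its inverse. It gives cubicity and later
    carries the rotation over. *)
Definition nbL u w : (T + U)%type := if J u w then inl w else inr (port u).
Definition backL u (z : (T + U)%type) := if z is inl w then w else mate u.

Lemma J_mate u w : H u w -> ~~ J u w -> u \in ports /\ w = mate u.
Proof. by move=> h; rewrite del2E h negbK => /andP[? /eqP]. Qed.

Lemma J_mateF u : u \in ports -> J u (mate u) = false.
Proof. by move=> pu; rewrite del2E pu eqxx andbF. Qed.

Lemma nbL_mate u : u \in ports -> nbL u (mate u) = inr (port u).
Proof. by move=> pu; rewrite /nbL J_mateF. Qed.

Lemma nbL_nbhd u w : H u w -> G (inl u) (nbL u w).
Proof.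
move=> h; rewrite /nbL; case: ifPn => [j|/(J_mate h)[pu _]]; first by rewrite dotLL.
by rewrite dotLR pu eqxx.
Qed.

Lemma nbLK u w : H u w -> backL u (nbL u w) = w.
Proof. by move=> h; rewrite /nbL; case: ifPn => [//|/(J_mate h)[_ ->]]. Qed.

Lemma backL_nbhd u z : G (inl u) z -> H u (backL u z).
Proof.
case: z => [w|v]; first by rewrite dotLL /J /del2 => /andP[].
by rewrite dotLR => /andP[pu _]; apply: H_mate.
Qed.

Lemma backLK u z : G (inl u) z -> nbL u (backL u z) = z.
Proof.
case: z => [w|v]; first by rewrite dotLL /= /nbL => ->.
by rewrite /backL dotLR => /andP[pu /eqP->]; rewrite nbL_mate.
Qed.

(* The junk value of [unprt] outside the four attachment vertices is [a]. *)
Definition unprt (v : T') := nth a ports (index v [:: a'; b'; c'; d']).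

Lemma prtK u : u \in ports -> unprt (prt u) = u.
Proof.
by case/portsP=> ->; rewrite /unprt /prt /=; do ?rewrite !(eqxx, pE, qE, xE) /=.
Qed.

Definition inner (w : T') : U := insubd (port a) w.
(** The same bijection on the other side. No vertex is adjacent to both [x] and [y], so at most one
    neighbour is replaced and [backR] can recover it as a hub. *)
Definition nbR (v : U) w : (T + U)%type :=
  if (w == x) || (w == y) then inl (unprt (val v)) else inr (inner w).
Definition backR (v : U) (z : (T + U)%type) : T' :=
  if z is inr w then val w else hub (unprt (val v)).

Lemma innerK w : (w == x) || (w == y) = false -> val (inner w) = w.
Proof. by move=> h; rewrite /inner val_insubd -negb_or h. Qed.

Lemma nbR_hub u : u \in ports -> nbR (port u) (hub u) = inl u.
Proof. by move=> pu; rewrite /nbR hub_xy prtK. Qed.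

Lemma innerP (v : U) : (val v == x) || (val v == y) = false.
Proof. by case: v => v /= h; rewrite -[LHS]negbK negb_or h. Qed.

Lemma nbr_hubU (v : U) z : H' (val v) z -> (z == x) || (z == y) ->
  exists2 u, u \in ports & v = port u /\ z = hub u.
Proof.
move=> h zxy; have [vx vy] : val v != x /\ val v != y by case: v {h} => v /= /andP.
have [u [pu vu zu]] := nbr_hub vx vy zxy (etrans (symH' _ _) h).
by exists u => //; split=> //; apply: val_inj.
Qed.

Lemma nbR_nbhd (v : U) w : H' (val v) w -> G (inr v) (nbR v w).
Proof.
move=> h; case E: ((w == x) || (w == y)).
  have [u pu [-> ->]] := nbr_hubU h E.
  by rewrite nbR_hub // dotRL pu eqxx.
by rewrite /nbR E dotRR innerK.
Qed.

Lemma nbRK (v : U) w : H' (val v) w -> backR v (nbR v w) = w.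
Proof.
move=> h; case E: ((w == x) || (w == y)).
  have [u pu [-> ->]] := nbr_hubU h E.
  by rewrite nbR_hub //= prtK.
by rewrite /nbR E /= innerK.
Qed.

Lemma backR_nbhd v z : G (inr v) z -> H' (val v) (backR v z).
Proof.
case: z => [w|w] //; rewrite dotRL => /andP[pu /eqP->] /=.
by rewrite prtK // prt_hub.
Qed.

Lemma backRK v z : G (inr v) z -> nbR v (backR v z) = z.
Proof.
case: z => [w|w]; last first.
  by rewrite /backR /nbR innerP => _; congr inr; apply: val_inj; rewrite innerK ?innerP.
by rewrite dotRL /backR => /andP[pu /eqP->]; rewrite prtK // nbR_hub.
Qed.

Lemma nbhdL u : nbhd G (inl u) = nbL u @: nbhd H u.
Proof.
apply/setP=> z; rewrite inE; apply/idP/imsetP => [h|[w]].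
  by exists (backL u z); rewrite ?inE ?backL_nbhd ?backLK.
by rewrite inE => h ->; apply: nbL_nbhd.
Qed.

Lemma nbhdR v : nbhd G (inr v) = nbR v @: nbhd H' (val v).
Proof.
apply/setP=> z; rewrite inE; apply/idP/imsetP => [h|[w]].
  by exists (backR v z); rewrite ?inE ?backR_nbhd ?backRK.
by rewrite inE => h ->; apply: nbR_nbhd.
Qed.

Lemma nbL_inj u : {in nbhd H u &, injective (nbL u)}.
Proof. by apply: (can_in_inj (g := backL u)) => w; rewrite inE => /nbLK. Qed.

Lemma nbR_inj v : {in nbhd H' (val v) &, injective (nbR v)}.
Proof. by apply: (can_in_inj (g := backR v)) => w; rewrite inE => /nbRK. Qed.

Lemma dot_cubic : cubic G.
Proof.
case=> u.
  by rewrite nbhdL card_in_imset ?(ds_cub DS) //; apply: nbL_inj.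
by rewrite nbhdR card_in_imset ?(ds_cub' DS) //; apply: nbR_inj.
Qed.

(** * Hamiltonian cycles avoiding one vertex *)

Lemma walkGL p q s : walk G (inl p) (inl q) (map inl s) = walk J p q s.
Proof. by apply: walk_map => // u v []. Qed.

Lemma walkGR (p q : U) r :
  walk G (inr p) (inr q) (map inr r) = walk H' (val p) (val q) (map val r).
Proof.
rewrite (walk_map (e1 := relpre val H')) //; last by move=> u v [].
by rewrite (walk_map (e1 := relpre val H')) //; apply: val_inj.
Qed.

Lemma inner_seq (r : seq T') : (forall v, v \in r -> (v != x) && (v != y)) ->
  exists r' : seq U, r = map val r'.
Proof.
elim: r => [|v r IH] h; first by exists [::].
have [r' ->] := IH (fun w wr => h w (mem_behead (s := v :: r) wr)).
have hv := h v (mem_head _ _).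
by exists (exist (fun v => (v != x) && (v != y)) v hv :: r').
Qed.

Lemma J_sub : subrel J H.
Proof. by move=> u v /andP[]. Qed.

Lemma hamiltonian_on_lr (S : {set T + U}) L : cycle G L -> uniq (lefts L) -> uniq (rights L) ->
  (forall u, (u \in lefts L) = (inl u \in S)) -> (forall v, (v \in rights L) = (inr v \in S)) ->
  2 < #|S| -> hamiltonian_on G S.
Proof.
move=> C Ul Ur Ml Mr Z; exists L.
have UL : uniq L by rewrite uniq_lr Ul Ur.
have ML : L =i S by case=> u; rewrite -?mem_lefts -?mem_rights ?Ml ?Mr.
by split=> //; rewrite (card_seqE UL ML).
Qed.

Lemma card_minus (v : T + U) : 6 <= #|T| -> 2 < #|[set~ v]|.
Proof.
move=> T6; have := cardsC1 v; rewrite card_sum => ->.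
by rewrite -ltnS prednK ?(leq_trans _ (leq_addr _ _)) // (leq_trans _ T6).
Qed.

Lemma dotLR_port u : u \in ports -> G (inl u) (inr (port u)).
Proof. by move=> pu; rewrite dotLR pu eqxx. Qed.

Lemma dotRL_port u : u \in ports -> G (inr (port u)) (inl u).
Proof. by move=> pu; rewrite dotRL pu eqxx. Qed.

(** A hamiltonian cycle of [H'] minus the other hub must pass through [hub u] between its two
    remaining neighbours, the attachment vertices of [u] and [mate u]. Removing [hub u] leaves the
    path. *)
Lemma ham_inner_mate u : hypohamiltonian H' -> u \in ports -> exists r,
  [/\ walk G (inr (port u)) (inr (port (mate u))) (map inr r), uniq r & forall v, v \in r].
Proof.
move=> [_ hyp] pu.
pose z := if hub u == x then y else x.
have hz : hub u != z.
  by rewrite /z; case: (hub u =P x) => [->|/eqP//]; rewrite xE.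
have zxy v : (v != x) && (v != y) = (v != hub u) && (v != z).
  rewrite /z; case: (hub u =P x) => [->//|/eqP h]; rewrite andbC.
  by have := hub_xy u; rewrite (negPf h) /= => /eqP->.
have hS : hub u \in [set~ z] by rewrite !inE.
have [p [q [r [W hp qh pq [Ur M]]]]] := ham_cycle_at (hyp z) hS.
have inn v : v \in r -> (v != x) && (v != y).
  move=> vr; rewrite zxy; move: (M v); rewrite !inE vr orbT => <-; rewrite andbT.
  by case/andP: Ur => + _; apply: contraNneq => <-.
have [r' Er] := inner_seq inn.
have [px py] := andP (inn _ (walk_headP W)); have [qx qy] := andP (inn _ (walk_lastP W)).
have [u1 [pu1 p1 h1]] := nbr_hub px py (hub_xy u) hp.
have [u2 [pu2 p2 h2]] := nbr_hub qx qy (hub_xy u) (etrans (symH' _ _) qh).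
have u12 : u1 != u2 by apply: contraNneq pq => E; rewrite p1 p2 E.
have Eu2 : u2 = mate u1 by apply/eqP; rewrite -hub_eq // -h1 -h2.
have Ur' : uniq r' by move: Ur; rewrite Er /= => /andP[_ /map_uniq].
have Mr' v : v \in r'.
  rewrite -(mem_map val_inj) -Er; have := M (val v); rewrite !inE.
  by have := negbT (innerP v); rewrite negb_or zxy => /andP[/negPf-> ->].
case: (eqVneq u u1) => [E|uu1].
  by exists r'; split=> //; rewrite walkGR /= -Er E -Eu2 -p1 -p2.
have Eu1 : u1 = mate u by apply/eqP; rewrite -hub_eq // -h1.
exists (rev r'); split; rewrite ?rev_uniq //; last by move=> v; rewrite mem_rev.
rewrite map_rev walk_rev //; first exact: dot_sym.
by rewrite walkGR /= -Er -Eu1 -p1; move: W; rewrite p2 Eu2 Eu1 mateK.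
Qed.

Lemma hamiltonian_minus_left u t : 6 <= #|T| -> hypohamiltonian H' -> u \in ports ->
  good_pair J [set~ t] u (mate u) -> hamiltonian_on G [set~ inl t].
Proof.
move=> T6 hyp pu /good_pairP[s [W Us Ms]].
have [r [Wr Ur Mr]] := ham_inner_mate hyp (mate_port u).
apply: (@hamiltonian_on_lr _ (map inl s ++ map inr r)); rewrite ?lrE //.
- rewrite mateK // in Wr.
  apply: (walk_cycle (p := inl u) (q := inr (port u))); last exact: dotRL_port.
  by apply: (walk_cat (q := inl (mate u)) _ _ Wr); rewrite ?walkGL // dotLR_port ?mate_port.
- by move=> v; rewrite Ms !inE.
- by move=> v; rewrite Mr !inE.
- exact: card_minus.
Qed.

(** If [x] and [y] are consecutive on the hamiltonian cycle of [H' - v], deleting them leaves one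
    path, otherwise two. Each path joins a neighbour of [x] to one of [y], and in the second case
    cubicity makes the ends of the two paths mates of each other. *)
Lemma inner_minus v : hypohamiltonian H' -> exists u w, [/\ u \in ports, w \in ports, hub u != hub w &
  (exists r, [/\ walk G (inr (port u)) (inr (port w)) (map inr r), uniq r & r =i predC1 v]) \/
  (exists r1 r2, [/\ walk G (inr (port u)) (inr (port w)) (map inr r1),
                    walk G (inr (port (mate w))) (inr (port (mate u))) (map inr r2),
                    uniq (r1 ++ r2) & r1 ++ r2 =i predC1 v])].
Proof.
move=> [_ hyp].
have [vx vy] : val v != x /\ val v != y by case: (v) => w /= /andP.
have xS : x \in [set~ val v] by rewrite !inE eq_sym.
have yS : y \in [set~ val v] by rewrite !inE eq_sym.
have [p [q [r [W xp qx pq [Ur M]]]]] := ham_cycle_at (hyp (val v)) xS.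
have yr : y \in r by move: (M y); rewrite yS inE xE.
(* The case in which [y] comes right after [x]. If it comes right before, the same is applied to the
   reversed path. *)
have step p1 q1 r1 : walk H' p1 q1 (y :: r1) -> H' q1 x -> uniq (x :: y :: r1) ->
    x :: y :: r1 =i [set~ val v] -> p1 != q1 ->
    exists u w, [/\ u \in ports, w \in ports, hub u != hub w &
     exists r, [/\ walk G (inr (port u)) (inr (port w)) (map inr r), uniq r & r =i predC1 v]].
  move=> W1 q1x U1 M1 pq1.
  have r10 : r1 != [::].
    by apply: contraNneq pq1 => E; move: W1; rewrite E /= => /andP[/eqP <-].
  have [y1 [p2 [W2 E2 W3]]] := walk_split (s1 := [:: y]) W1 isT r10.
  have {}E2 : H' y p2 by move: W2 E2; rewrite /= => /andP[_ /eqP <-].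
  have inn z : z \in r1 -> (z != x) && (z != y).
    case/and3P: U1; rewrite inE negb_or => /andP[_ xr] yr1 _ zr.
    by apply/andP; split; apply: contraTneq zr => ->.
  have [p2x p2y] := andP (inn _ (walk_headP W3)).
  have [q1x' q1y] := andP (inn _ (walk_lastP W3)).
  have yxy : (y == x) || (y == y) by rewrite eqxx orbT.
  have xxy : (x == x) || (x == y) by rewrite eqxx.
  have [u [pu Eu hu]] := nbr_hub p2x p2y yxy E2.
  have [w [pw Ew hw]] := nbr_hub q1x' q1y xxy (etrans (symH' _ _) q1x).
  have [r' Er] := inner_seq inn.
  exists u, w; split=> //; first by rewrite -hu -hw xE.
  exists r'; split; first by rewrite walkGR /= -Er -Eu -Ew.
    by move: U1; rewrite Er /= => /and3P[_ _ /map_uniq].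
  move=> z; rewrite -(mem_map val_inj) -Er; have := M1 (val z).
  rewrite !inE; have /norP[/negPf-> /negPf->] := negbT (innerP z).
  by rewrite (inj_eq val_inj).
case: (eqVneq p y) => [py|pNy].
  have [r1 Er] : exists r1, r = y :: r1 by move/walkP: W => [r1 [-> _ _]]; exists r1; rewrite py.
  subst r; have [u [w [pu pw hn h]]] := step _ _ _ W qx Ur M pq.
  by exists u, w; split=> //; left.
case: (eqVneq q y) => [qy|qNy].
  have Wr := walk_rev symH' W.
  have [r1 Er] : exists r1, rev r = y :: r1.
    by move/walkP: Wr => [r1 [-> _ _]]; exists r1; rewrite qy.
  rewrite Er in Wr; have := step _ _ _ Wr (etrans (symH' _ _) xp).
  rewrite -Er [uniq _]/= mem_rev rev_uniq => /(_ Ur).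
  case=> [z||u [w [pu pw hn h]]]; first by rewrite -M !inE mem_rev.
    by rewrite eq_sym.
  by exists u, w; split=> //; left.
have [r1 [r2 Er]] : exists r1 r2, r = r1 ++ y :: r2 by case/splitPr: yr => r1 r2; exists r1, r2.
have r10 : r1 != [::].
  by apply: contraNneq pNy => E; move: W; rewrite Er E /= => /andP[/eqP <-].
have r20 : r2 != [::].
  apply: contraNneq qNy => E; move: W; rewrite Er E => /walkP[s [Es _ <-]].
  have := congr1 (last y) Es; rewrite last_cat /= => -> //.
rewrite Er in W; have [q1 [y1 [W1 E1 W2]]] := walk_split W r10 isT.
have [y2 [p2 [W3 E2 W4]]] := walk_split (s1 := [:: y]) W2 isT r20.
have y1E : y = y1 by move: W3; rewrite /= => /andP[/eqP].
have y2E : y = y2 by move: W3; rewrite /= => /andP[_ /eqP].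
subst y1 y2.
have Up : perm_eq r (y :: r1 ++ r2) by rewrite Er -[y :: r2]cat1s perm_catCA.
have inn z : z \in r1 ++ r2 -> (z != x) && (z != y).
  move: Ur; rewrite /= (perm_uniq Up) (perm_mem Up) inE negb_or => /and3P[/andP[_ xr]].
  move=> yr12 _ zr; by apply/andP; split; apply: contraTneq zr => ->.
have inn1 z : z \in r1 -> (z != x) && (z != y) by move=> zr; apply: inn; rewrite mem_cat zr.
have inn2 z : z \in r2 -> (z != x) && (z != y) by move=> zr; apply: inn; rewrite mem_cat zr orbT.
have [r1' Er1] := inner_seq inn1; have [r2' Er2] := inner_seq inn2.
have Er12 : r1 ++ r2 = map val (r1' ++ r2') by rewrite map_cat -Er1 -Er2.
have Ur12 : uniq (r1 ++ r2) by move: Ur; rewrite /= (perm_uniq Up) /= => /and3P[].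
have yxy : (y == x) || (y == y) by rewrite eqxx orbT.
have xxy : (x == x) || (x == y) by rewrite eqxx.
have [p1x p1y] := andP (inn1 _ (walk_headP W1)); have [q1x q1y] := andP (inn1 _ (walk_lastP W1)).
have [p2x p2y] := andP (inn2 _ (walk_headP W4)); have [q2x q2y] := andP (inn2 _ (walk_lastP W4)).
have [u [pu Eu hu]] := nbr_hub p1x p1y xxy xp.
have [u' [pu' Eu' hu']] := nbr_hub q2x q2y xxy (etrans (symH' _ _) qx).
have [w [pw Ew hw]] := nbr_hub q1x q1y yxy (etrans (symH' _ _) E1).
have [w' [pw' Ew' hw']] := nbr_hub p2x p2y yxy E2.
have uu' : u != u' by apply: contraNneq pq => E; rewrite Eu Eu' E.
have ww' : w != w'.
  apply: contraTneq Ur12 => E; rewrite cat_uniq.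
  suff -> : has (mem r1) r2 by rewrite andbF.
  apply/hasP; exists q1; last exact: (walk_lastP W1).
  by rewrite Ew E -Ew' (walk_headP W4).
have mu : u' = mate u by apply/eqP; rewrite -hub_eq // -hu -hu'.
have mw : w' = mate w by apply/eqP; rewrite -hub_eq // -hw -hw'.
exists u, w; split=> //; first by rewrite -hu -hw xE.
right; exists r1', r2'; split.
- by rewrite walkGR /= -Er1 -Eu -Ew.
- by rewrite walkGR /= -Er2 -mu -mw -Eu' -Ew'.
- by rewrite -(map_inj_uniq val_inj) -Er12.
- move=> z; rewrite -(mem_map val_inj) -Er12; have := M (val z).
  rewrite inE (perm_mem Up) !inE; have /norP[/negPf-> /negPf->] := negbT (innerP z).
  by rewrite (inj_eq val_inj).
Qed.

(** Two paths of [J'] both run between the hubs, while the two paths of [J] join each port to its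
    mate, at the same hub. Hence the four pieces form one cycle and not two. *)
Lemma hamiltonian_minus_right v : 6 <= #|T| -> hypohamiltonian H' ->
  (forall u w, u \in ports -> w \in ports -> hub u != hub w -> good_pair J [set: T] u w) ->
  (forall u w, u \in ports -> w \in ports -> hub u != hub w ->
     good_pairs J [set: T] (mate u) u w (mate w)) ->
  hamiltonian_on G [set~ inr v].
Proof.
move=> T6 hyp gp gps; have [u [w [pu pw huw [[r [W Ur Mr]]|[r1 [r2 [W1 W2 Ur Mr]]]]]]] := inner_minus v hyp.
  have [s [Ws Us Ms]] := (good_pairP _ _ _ _).1 (gp w u pw pu (etrans (congr1 negb (eq_sym _ _)) huw)).
  apply: (@hamiltonian_on_lr _ (map inl s ++ map inr r)); rewrite ?lrE //.
  - apply: (walk_cycle (p := inl w) (q := inr (port w))); last exact: dotRL_port.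
    by apply: (walk_cat (q := inl u) _ _ W); rewrite ?walkGL // dotLR_port.
  - by move=> z; rewrite Ms !inE.
  - by move=> z; rewrite Mr !inE.
  - exact: card_minus.
have [s1 [s2 [Ws1 Ws2 Us Ms]]] := (good_pairsP _ _ _ _ _ _).1 (gps u w pu pw huw).
apply: (@hamiltonian_on_lr _ (map inl s1 ++ map inr r1 ++ map inl s2 ++ map inr r2)); rewrite ?lrE //.
- apply: (walk_cycle (p := inl (mate u)) (q := inr (port (mate u)))).
    apply: (walk_cat (q := inl u) (p' := inr (port u))); rewrite ?walkGL ?dotLR_port //.
    apply: (walk_cat W1 (dotRL_port pw)).
    by apply: (walk_cat (q := inl (mate w)) _ _ W2); rewrite ?walkGL ?dotLR_port ?mate_port.
  exact/dotRL_port/mate_port.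
- by move=> z; rewrite Ms !inE.
- by move=> z; rewrite Mr !inE.
- exact: card_minus.
Qed.

(** * Cycles of the dot product cut at the crossing edges: girth and non-hamiltonicity *)

Lemma close_two_hubs p q r : walk G (inr (port q)) (inr (port p)) (map inr r) ->
  p \in ports -> q \in ports -> p != q -> q != mate p -> uniq r ->
  uniq (map val r ++ [:: hub p; hub q]) /\ cycle H' (map val r ++ [:: hub p; hub q]).
Proof.
rewrite walkGR /= => W pp pq pq' mpq Ur.
have hpq : hub p != hub q by rewrite hub_eq.
split; last first.
  apply: (walk_cycle (p := prt q) (q := hub q)); last exact: hub_prt.
  apply: (walk_cat W (prt_hub pp)); rewrite /= hub_edge // !eqxx.
  done.
rewrite cat_uniq map_inj_uniq ?Ur /=; last exact: val_inj.
rewrite inE hpq orbF negb_or !andbT.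
have hout u : hub u \notin map val r.
  by apply/mapP=> -[v _ E]; have := innerP v; rewrite [val v](esym E) hub_xy.
by rewrite !hout.
Qed.

Lemma close_hub p r : walk G (inr (port (mate p))) (inr (port p)) (map inr r) ->
  p \in ports -> uniq r ->
  uniq (rcons (map val r) (hub p)) /\ cycle H' (rcons (map val r) (hub p)).
Proof.
rewrite walkGR /= => W pp Ur; split.
  rewrite rcons_uniq map_inj_uniq ?Ur ?andbT; last exact: val_inj.
  by apply/mapP=> -[v _ E]; have := innerP v; rewrite [val v](esym E) hub_xy.
rewrite -cats1; apply: (walk_cycle (p := prt (mate p)) (q := hub p)).
  by apply: (walk_cat W (prt_hub pp)); rewrite /= !eqxx.
by rewrite -hub_mate // hub_prt // mate_port.
Qed.

Lemma hubs_or_inner p q v : hub p != hub q -> [\/ v = hub p, v = hub q | exists w : U, v = val w].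
Proof.
move=> hpq; case E: ((v == x) || (v == y)); last first.
  constructor 3; move/negbT: E; rewrite negb_or => h.
  by exists (exist (fun v => (v != x) && (v != y)) v h).
case/orP: (hub_xy p) hpq E => /eqP->; case/orP: (hub_xy q) => /eqP->; rewrite ?eqxx // => _ /orP[];
  move/eqP->; by [constructor 1|constructor 2].
Qed.

Lemma dotLR_inv u z v : z = inr v -> G (inl u) z -> u \in ports /\ z = inr (port u).
Proof. by move=> ->; rewrite dotLR => /andP[pu /eqP->]. Qed.

Lemma dotRL_inv u z v : z = inr v -> G z (inl u) -> u \in ports /\ z = inr (port u).
Proof. by move=> ->; rewrite dotRL => /andP[pu /eqP->]. Qed.

Lemma lr_word_walk p q L : lr_word L -> walk G p q L -> exists u v, p = inl u /\ q = inr v.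
Proof.
case/lr_wordP=> u [L' [v ->]] /= /and3P[/eqP <- _ /eqP <-].
by exists u, v; rewrite last_rcons.
Qed.

Lemma cycle_lr_walk L : lr_word L -> cycle G L ->
  exists2 p, p \in ports & walk G (inl p) (inr (port p)) L.
Proof.
move=> w C; have L0 : L != [::] by case: (L) w.
have [P [Q [W QP]]] := cycle_walk C L0.
have [u [v [Eu Ev]]] := lr_word_walk w W; subst P.
by have [pu Q1] := dotRL_inv Ev QP; exists u; rewrite -?Q1.
Qed.

(** Reads off the ports of the crossings. The walk leaves the left side at [q] and comes back at
    [k]; [p] is the port of the edge that closes the cycle, so it equals [k] when nothing
    follows. *)
Lemma walk_runs l p s r L2 :
  walk G (inl l) (inr (port p)) (map inl s ++ map inr r ++ L2) -> p \in ports ->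
  s != [::] -> r != [::] -> (L2 == [::]) || lr_word L2 ->
  exists q k, [/\ q \in ports, walk J l q s, k \in ports,
     walk G (inr (port q)) (inr (port k)) (map inr r) &
     if L2 == [::] then k = p else walk G (inl k) (inr (port p)) L2].
Proof.
move=> W pp s0 r0 hL2.
have sm0 : map (@inl T U) s != [::] by case: (s) s0.
have rm0 : map (@inr T U) r != [::] by case: (r) r0.
have rL0 : map (@inr T U) r ++ L2 != [::] by case: (r) r0.
have [Q1 [P1 [W1 E1 W2]]] := walk_split W sm0 rL0.
have [p1 [q [Pp Qq]]] := walk_map_ends W1; subst Q1.
rewrite walkGL in W1.
case: (eqVneq L2 [::]) hL2 W2 => [->|L20] /= hL2 W2.
  rewrite cats0 in W2; have [h [k [Eh Ek]]] := walk_map_ends W2.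
  have [pq Eq] := dotLR_inv Eh E1.
  by exists q, p; split=> //; rewrite -Eq.
have [Q2 [P2 [W3 E2 W4]]] := walk_split W2 rm0 L20.
have [h [k [Eh Ek]]] := walk_map_ends W3.
have [u [v [Eu Ev]]] := lr_word_walk hL2 W4.
have [pq Eq] := dotLR_inv Eh E1.
rewrite Eu in E2 W4; have [pu Epu] := dotRL_inv Ek E2.
by exists q, u; split=> //; rewrite -?Eq -?Epu.
Qed.

Lemma girth_dot g g' L : is_girth H g -> is_girth H' g' -> is_cycle G L -> minn g g' <= size L.
Proof.
move=> [_ hg] [_ hg'] /and3P[UL ZL CL].
case: (eqVneq (rights L) [::]) => [/all_left[s E]|r0].
  apply: leq_trans (geq_minl g g') _.
  rewrite E size_map; apply: hg; apply/and3P; split.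
  - by move: UL; rewrite E => /map_uniq.
  - by move: ZL; rewrite E size_map.
  - move: CL; rewrite E cycle_map; apply: sub_cycle => u v; exact: J_sub.
case: (eqVneq (lefts L) [::]) => [/all_right[r E]|l0].
  apply: leq_trans (geq_minr g g') _.
  rewrite E size_map -(size_map val); apply: hg'; apply/and3P; split.
  - by move: UL; rewrite E !map_inj_uniq //; [apply: val_inj | move=> ? ? []].
  - by move: ZL; rewrite E !size_map.
  - by move: CL; rewrite E !cycle_map.
have [m [n w]] := lr_word_rot l0 r0; move: w UL ZL CL {l0 r0}.
rewrite -(size_rot m L) -(size_rot n (rot m L)) -(rot_cycle m) -(rot_cycle n).
rewrite -(rot_uniq m) -(rot_uniq n); move: (rot n _) => {}L w UL ZL CL.
have [s [r [L2 [EL s0 r0 hL2]]]] := lr_word_cut w; subst L.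
have [p pp W] := cycle_lr_walk w CL.
have [q [k [pq Ws pk Wr hk]]] := walk_runs W pp s0 r0 hL2.
have [Ul Ur] : uniq (s ++ lefts L2) /\ uniq (r ++ rights L2).
  by move: UL; rewrite uniq_lr !lrE => /andP.
have {}Ur : uniq r by move: Ur; rewrite cat_uniq => /and3P[].
(* If [k = q], either the whole cycle consists of [p] and [port p], which is too short, or the
   vertex [q] occurs twice. *)
have kq : k != q.
  case: (eqVneq L2 [::]) hk => [L20 kp|L20 hk].
    apply/eqP=> E; subst q k; move: ZL; rewrite L20 cats0.
    have -> : s = [:: p] by apply: walk_loop Ws; move: Ul; rewrite L20 cats0.
    have -> // : map inr r = [:: inr (port p)] :> seq (T + U).
    by apply: walk_loop Wr; rewrite map_inj_uniq // => ? ? [].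
  rewrite eq_sym; apply: (uniq_cat_neq Ul (walk_lastP Ws)).
  by rewrite mem_lefts (walk_headP hk).
(* The left vertices [k] and [q] of the cycle pay for the one or two hubs that close [r] in [H']. *)
have ZL2 : size r + 2 <= size (map inl s ++ map inr r ++ L2).
  rewrite size_lr !lrE !size_cat.
  suff h : 2 <= size (s ++ lefts L2).
    by rewrite -[size s + _]size_cat [size r + 2]addnC leq_add // leq_addr.
  apply: (@uniq_leq_size _ [:: k; q]); first by rewrite /= inE kq.
  move=> z; rewrite !inE => /orP[] /eqP->; rewrite mem_cat ?(walk_lastP Ws) //.
  case: (eqVneq L2 [::]) hk => [_ ->|_ /walk_headP]; first by rewrite (walk_headP Ws).
  by rewrite -mem_lefts => ->; rewrite orbT.
(* Closing through a single hub must still give length at least 3. *)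
have Z2 : 2 <= size r.
  rewrite -(size_map (@inr T U)).
  apply: (@uniq_leq_size _ [:: inr (port q); inr (port k)]).
    rewrite /= inE andbT; apply: contraNneq kq => -[E].
    by apply/eqP/esym/prt_inj.
  by move=> z; rewrite !inE => /orP[] /eqP->; rewrite ?(walk_headP Wr) ?(walk_lastP Wr).
apply: leq_trans (geq_minr g g') _; apply: leq_trans ZL2.
case: (eqVneq q (mate k)) => [E|qk].
  rewrite E in Wr; have [U1 C1] := close_hub Wr pk Ur.
  have := hg' (rcons (map val r) (hub k)); rewrite /is_cycle U1 C1 size_rcons size_map.
  by rewrite ltnS Z2 addn2 => /(_ isT) /leqW.
have [U1 C1] := close_two_hubs Wr pk pq kq qk Ur.
have := hg' (map val r ++ [:: hub k; hub q]); rewrite /is_cycle U1 C1 size_cat size_map /=.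
by rewrite andbT addn2 ltnS ltnW // => /(_ isT).
Qed.

Lemma dot_not_hamiltonian : 6 <= #|T| -> 6 <= #|T'| ->
  ~ hamiltonian H -> ~ hamiltonian H' -> ~ hamiltonian G.
Proof.
move=> T6 T6' nH nH' [L hL].
have l0 : lefts L != [::].
  have: a \in lefts L by case: hL => _ M _ _; rewrite mem_lefts M inE.
  by case: (lefts L).
have r0 : rights L != [::].
  have: port a \in rights L by case: hL => _ M _ _; rewrite mem_rights M inE.
  by case: (rights L).
have [m [n w]] := lr_word_rot l0 r0.
have {hL} := ham_cycle_rot n (ham_cycle_rot m hL).
move: (rot n _) w => {l0 r0 m n}L w [UL ML ZL CL].
have [s [r [L2 [EL s0 r0 hL2]]]] := lr_word_cut w; subst L.
have [p pp W] := cycle_lr_walk w CL.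
have [q [k [pq Ws pk Wr hk]]] := walk_runs W pp s0 r0 hL2.
have Ml u : u \in s ++ lefts L2.
  by have := ML (inl u); rewrite -mem_lefts !lrE inE.
have Mr v : v \in r ++ rights L2.
  by have := ML (inr v); rewrite -mem_rights !lrE inE.
have [Ul Ur] : uniq (s ++ lefts L2) /\ uniq (r ++ rights L2).
  by move: UL; rewrite uniq_lr !lrE => /andP.
case: (eqVneq L2 [::]) hL2 hk => [L20 _ kp|L20 /= hL2 hk].
  rewrite L20 !cats0 in Ml Mr Ul Ur; subst k.
  case: (eqVneq q (mate p)) => [E|qp].
    apply: nH; apply: (hamiltonian_seq T6 Ul Ml).
    by apply: (walk_cycle (sub_walk J_sub Ws)); rewrite E symH H_mate.
  (* A left path with equal ends is a single vertex and misses [mate p]. *)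
  have pNq : p != q.
    apply/eqP=> E; subst q.
    by have := walk_loop Ul Ws => Es; have := Ml (mate p); rewrite Es inE (negPf (mate_neq pp)).
  have [U1 C1] := close_two_hubs Wr pk pq pNq qp Ur.
  have hpq : hub p != hub q by rewrite hub_eq.
  apply: nH'; apply: (hamiltonian_seq T6' U1 _ C1) => v; rewrite mem_cat !inE.
  case: (hubs_or_inner v hpq) => [->|->|[z ->]]; rewrite ?eqxx ?orbT //.
  by rewrite (map_f val (Mr z)).
have [s2 [r2 [L3 [EL s20 r20 hL3]]]] := lr_word_cut hL2; subst L2.
rewrite !lrE in Ml Mr Ul Ur.
have [q2 [k2 [pq2 Ws2 pk2 Wr2 hk2]]] := walk_runs hk pp s20 r20 hL3.
have Ul12 : uniq (s ++ s2) by move: Ul; rewrite catA cat_uniq => /and3P[].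
have Ur12 : uniq (r ++ r2) by move: Ur; rewrite catA cat_uniq => /and3P[].
have inr_mem v t : inr v \in map (@inr T U) t -> v \in t by rewrite mem_map // => ? ? [].
have hq : port q \in r by apply/inr_mem/(walk_headP Wr).
have hk' : port k \in r by apply/inr_mem/(walk_lastP Wr).
have hq2 : port q2 \in r2 by apply/inr_mem/(walk_headP Wr2).
have hk2' : port k2 \in r2 by apply/inr_mem/(walk_lastP Wr2).
have pNq : p != q.
  suff: port p \in r2 ++ rights L3.
    by move/(uniq_cat_neq Ur hq); apply: contraNneq => ->.
  rewrite mem_cat; case: (eqVneq L3 [::]) hk2 => [_ <-|_ /walk_lastP]; first by rewrite hk2'.
  by rewrite -mem_rights => ->; rewrite orbT.
have kNq2 : k != q2 by apply: contraNneq (uniq_cat_neq Ur12 hk' hq2) => ->.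
have [pNk pNq2] : p != k /\ p != q2.
  by split; apply: (uniq_cat_neq Ul12 (walk_headP Ws)); rewrite ?(walk_headP Ws2) ?(walk_lastP Ws2).
have [qNk qNq2] : q != k /\ q != q2.
  by split; apply: (uniq_cat_neq Ul12 (walk_lastP Ws)); rewrite ?(walk_headP Ws2) ?(walk_lastP Ws2).
have U4 : uniq [:: p; q; k; q2].
  by rewrite /= !inE !negb_or pNq pNk pNq2 qNk qNq2 kNq2.
have S4 : {subset [:: p; q; k; q2] <= ports}.
  by apply/allP; rewrite [all _ _]/= pp pq pk pq2.
(* Two left runs exhaust the four ports, so a third one, which would begin at a further port [k2],
   cannot exist. *)
have P4 : ports =i [:: p; q; k; q2].
  by have [_ ?] := uniq_min_size U4 S4 (leqnn 4).
case: (eqVneq L3 [::]) hk2 => [L30 k2p|L30 hk2]; last first.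
  have k2L : k2 \in lefts L3 by rewrite mem_lefts (walk_headP hk2).
  have k2s : k2 \in s ++ s2.
    have := P4 k2; rewrite pk2 !inE => /esym/or4P[] /eqP->; rewrite mem_cat;
    by rewrite ?(walk_headP Ws) ?(walk_lastP Ws) ?(walk_headP Ws2) ?(walk_lastP Ws2) ?orbT.
  by rewrite catA in Ul; have := uniq_cat_neq Ul k2s k2L; rewrite eqxx.
subst k2; rewrite L30 !cats0 in Ml Mr.
have mateP z : z \in ports -> [\/ mate z = p, mate z = q, mate z = k | mate z = q2].
  move=> _; have := P4 (mate z); rewrite mate_port !inE => /esym/or4P[] /eqP->;
  by [constructor 1|constructor 2|constructor 3|constructor 4].
have inj z1 z2 z : z1 \in ports -> z2 \in ports -> mate z1 = z -> mate z2 = z -> z1 = z2.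
  by move=> h1 h2 e1 e2; rewrite -(mateK h1) e1 -e2 mateK.
have swap z1 z2 : z1 \in ports -> mate z1 = z2 -> mate z2 = z1.
  by move=> h1 <-; rewrite mateK.
have no z : z \in ports -> mate z <> z by move=> /mate_neq/eqP.
(* The cycle runs from [p] to [q], [port q] to [port k], [k] to [q2], [port q2] to [port p]. If
   [mate p = q], the hubs are inserted between the two right runs. If [mate p = k], the second left
   run has to be reversed; if [mate p = q2], the left runs follow each other as they are. *)
case: (mateP p pp) => [/(no _ pp)//|mp|mp|mp].
- have mk : mate k = q2.
    case: (mateP k pk) => // mk.
    + by case/eqP: qNk; rewrite -mp; apply: swap.
    + by case/eqP: pNk; apply: inj mp mk.
    + by case: (no _ pk).
  have hpk : hub p != hub k by rewrite hub_eq // mp eq_sym.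
  have hub_out u t : hub u \notin map val (t : seq U).
    by apply/mapP=> -[v _ E]; have := innerP v; rewrite [val v](esym E) hub_xy.
  apply: nH'; apply: (@hamiltonian_seq _ _ (hub p :: map val r ++ hub k :: map val r2)) => //.
  + have Uv : uniq (map val r ++ map val r2).
      by rewrite -map_cat map_inj_uniq //; apply: val_inj.
    rewrite cons_uniq mem_cat inE !negb_or !hub_out hpk /= .
    by rewrite (perm_uniq (permEl (perm_catCA (map val r) [:: hub k] (map val r2)))) /= mem_cat negb_or !hub_out.
  + move=> v; rewrite inE mem_cat inE.
    case: (hubs_or_inner v hpk) => [->|->|[z ->]]; rewrite ?eqxx ?orbT //.
    have := Mr z; rewrite mem_cat => /orP[] /(map_f val) ->; by rewrite ?orbT.
  + move: Wr Wr2; rewrite !walkGR => Wr Wr2.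
    apply: (walk_cycle (p := hub p) (q := prt p)); last exact: prt_hub.
    apply: (walk_cat (s := [:: hub p]) (walk1 H' (hub p)) (p' := prt q)).
      by rewrite -(hub_mate pp) mp hub_prt.
    apply: (walk_cat Wr (prt_hub pk)).
    apply: (walk_cat (s := [:: hub k]) (walk1 H' (hub k)) _ Wr2).
    by rewrite -(hub_mate pk) mk hub_prt.
- have mq : mate q = q2.
    case: (mateP q pq) => // mq.
    + by case/eqP: qNk; rewrite -mp; apply/esym/swap.
    + by case: (no _ pq).
    + by case/eqP: pNq; apply: inj mp mq.
  apply: nH; apply: (@hamiltonian_seq _ _ (s ++ rev s2)) => //.
  + rewrite cat_uniq rev_uniq; move: Ul12; rewrite cat_uniq => /and3P[-> + ->].
    by rewrite has_rev => ->.
  + by move=> v; rewrite mem_cat mem_rev -mem_cat.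
  + apply: (walk_cycle (p := p) (q := k)); last by rewrite -mp symH H_mate.
    apply: (walk_cat (sub_walk J_sub Ws) (p' := q2)); first by rewrite -mq H_mate.
    exact/(walk_rev symH)/(sub_walk J_sub).
have mq : mate q = k.
  case: (mateP q pq) => // mq.
  + by case/eqP: qNq2; rewrite -mp; apply/esym/swap.
  + by case: (no _ pq).
  + by case/eqP: pNq; apply: inj mp mq.
apply: nH; apply: (@hamiltonian_seq _ _ (s ++ s2)) => //.
apply: (walk_cycle (p := p) (q := q2)); last by rewrite -mp symH H_mate.
apply: (walk_cat (sub_walk J_sub Ws) _ (sub_walk J_sub Ws2)).
by rewrite -mq H_mate.
Qed.

(** * Gluing two plane rotation systems *)

Section Planarity.
Variables (rho : T -> T -> T) (rho' : T' -> T' -> T').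
Hypotheses (rs : rotation_system H rho) (rs' : rotation_system H' rho').
Hypotheses (rxy : rho' x y = a') (rxa : rho' x a' = b') (rxb : rho' x b' = y).
Hypotheses (ryx : rho' y x = c') (ryc : rho' y c' = d') (ryd : rho' y d' = x).
Hypothesis same_face : (c, d) \in face_of rho (a, b).

(** Each old rotation is transported by the bijection of neighbours: a new edge takes the place of
    the lost one in the cyclic order. *)
Definition rhoG (z q : T + U) : T + U :=
  match z with
  | inl u => nbL u (rho u (backL u q))
  | inr v => nbR v (rho' (val v) (backR v q))
  end.

Lemma rotation_system_dot : rotation_system G rhoG.
Proof.
case=> [u|v].
  have [r1 r2 r3] := rs u; rewrite nbhdL; split.
  - move=> z /imsetP[w wn ->]; rewrite /= nbLK; last by move: wn; rewrite inE.
    by rewrite imset_f ?r1.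
  - move=> z1 z2 /imsetP[w1 n1 ->] /imsetP[w2 n2 ->] /=.
    rewrite !nbLK; try by [move: n1; rewrite inE | move: n2; rewrite inE].
    by move/(nbL_inj (r1 _ n1) (r1 _ n2))/(r2 _ _ n1 n2)->.
  - move=> z1 z2 /imsetP[w1 n1 ->] /imsetP[w2 n2 ->]; have [k <-] := r3 _ _ n1 n2.
    exists k; suff [] : iter k (rhoG (inl u)) (nbL u w1) = nbL u (iter k (rho u) w1) /\
      iter k (rho u) w1 \in nbhd H u by [].
    elim: k => //= k [-> h]; split; last exact: r1.
    by rewrite nbLK //; move: h; rewrite inE.
have [r1 r2 r3] := rs' (val v); rewrite nbhdR; split.
- move=> z /imsetP[w wn ->]; rewrite /= nbRK; last by move: wn; rewrite inE.
  by rewrite imset_f ?r1.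
- move=> z1 z2 /imsetP[w1 n1 ->] /imsetP[w2 n2 ->] /=.
  rewrite !nbRK; try by [move: n1; rewrite inE | move: n2; rewrite inE].
  by move/(nbR_inj (r1 _ n1) (r1 _ n2))/(r2 _ _ n1 n2)->.
- move=> z1 z2 /imsetP[w1 n1 ->] /imsetP[w2 n2 ->]; have [k <-] := r3 _ _ n1 n2.
  exists k; suff [] : iter k (rhoG (inr v)) (nbR v w1) = nbR v (iter k (rho' (val v)) w1) /\
    iter k (rho' (val v)) w1 \in nbhd H' (val v) by [].
  elim: k => //= k [-> h]; split; last exact: r1.
  by rewrite nbRK //; move: h; rewrite inE.
Qed.

Let sgH := ds_sg DS.
Let sgH' := ds_sg' DS.
Let Z := (T * T + T' * T')%type.
Let phi := face_permD sgH rs.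
Let phi' := face_permD sgH' rs'.
Let pp : {perm Z} := sum_perm phi phi'.

(** The numbering lets products of transpositions be evaluated on indices. Numbers 0 to 3 are the
    removed edges of [H], 4 to 7 lead from the hubs to the attachment vertices, 8 to 11 are their
    reverses in the same order, and 12 and 13 join the hubs. *)
Definition surgery_darts : seq Z :=
  [:: inl (a, b); inl (b, a); inl (c, d); inl (d, c);
      inr (x, a'); inr (x, b'); inr (y, c'); inr (y, d');
      inr (a', x); inr (b', x); inr (c', y); inr (d', y); inr (x, y); inr (y, x)].

Let nm k : Z := nth (inl (a, b)) surgery_darts k.

Lemma uniq_surgery_darts : uniq surgery_darts.
Proof.
have i1 : injective (@inl (T * T) (T' * T')) by move=> ? ? [].
have i2 : injective (@inr (T * T) (T' * T')) by move=> ? ? [].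
rewrite (_ : surgery_darts = map inl [:: (a, b); (b, a); (c, d); (d, c)] ++
  map inr [:: (x, a'); (x, b'); (y, c'); (y, d'); (a', x); (b', x); (c', y); (d', y); (x, y); (y, x)]) //.
rewrite uniq_lr !lrE /= !inE !xpair_eqE.
rewrite ![x == a']eq_sym ![x == b']eq_sym ![x == c']eq_sym ![x == d']eq_sym.
rewrite ![y == a']eq_sym ![y == b']eq_sym ![y == c']eq_sym ![y == d']eq_sym.
by rewrite !(eqxx, pE, qE, xE).
Qed.

Lemma tperm_nm i j k : i < 14 -> j < 14 -> k < 14 ->
  tperm (nm i) (nm j) (nm k) = nm (if k == i then j else if k == j then i else k).
Proof.
move=> hi hj hk; rewrite permE /=.
by rewrite !(nth_uniq _ _ _ uniq_surgery_darts) //; do 2?case: ifP.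
Qed.

(* [psi] follows the faces of the dot product, with fixed points at the darts
   leaving [x] or [y].  The transposition of [s1] splits the common face of [ab]
   and [cd]; those of [s2] to [s7] isolate the darts leaving [x] and [y] one by
   one; the last four, each costing at most one cycle, connect the two sides. *)
Let s1 := (tperm (nm 0) (nm 2) * pp)%g.
Let s2 := (tperm (nm 4) (nm 13) * s1)%g.
Let s3 := (tperm (nm 13) (nm 11) * s2)%g.
Let s4 := (tperm (nm 5) (nm 8) * s3)%g.
Let s5 := (tperm (nm 6) (nm 12) * s4)%g.
Let s6 := (tperm (nm 12) (nm 9) * s5)%g.
Let s7 := (tperm (nm 7) (nm 10) * s6)%g.
Let s8 := (tperm (nm 0) (nm 11) * s7)%g.
Let s9 := (tperm (nm 2) (nm 9) * s8)%g.
Let s10 := (tperm (nm 1) (nm 8) * s9)%g.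
Let psi := (tperm (nm 3) (nm 10) * s10)%g.

Lemma ppL u w : H u w -> pp (inl (u, w)) = inl (w, rho w u).
Proof. by move=> h; rewrite permE /= /phi face_permD_dart. Qed.

Lemma ppR u w : H' u w -> pp (inr (u, w)) = inr (w, rho' w u).
Proof. by move=> h; rewrite permE /= /phi' face_permD_dart. Qed.

Lemma H'F : (H' a' x * H' b' x * H' c' y * H' d' y * H' x y * H' y x)%type.
Proof. by case: DS => *; do !split=> //; rewrite symH'. Qed.

(** The prescribed rotations at [x] and [y] enter here, through the six darts that end at a hub. *)
Lemma pp_nm : ((pp (nm 8) = nm 5) * (pp (nm 9) = nm 12) * (pp (nm 10) = nm 7) *
  (pp (nm 11) = nm 13) * (pp (nm 12) = nm 6) * (pp (nm 13) = nm 4))%type.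
Proof. by rewrite /nm /= !ppR ?H'F // rxa rxb ryc ryd ryx rxy. Qed.

Let sigma z := tperm (nm 0) (nm 2) (tperm (nm 4) (nm 13) (tperm (nm 13) (nm 11)
  (tperm (nm 5) (nm 8) (tperm (nm 6) (nm 12) (tperm (nm 12) (nm 9) (tperm (nm 7) (nm 10)
  (tperm (nm 0) (nm 11) (tperm (nm 2) (nm 9) (tperm (nm 1) (nm 8) (tperm (nm 3) (nm 10) z)))))))))).

Lemma psiE z : psi z = pp (sigma z).
Proof. by rewrite 11!permM. Qed.

Lemma sigma_out z : z \notin surgery_darts -> sigma z = z.
Proof.
move=> h; have D i j : i < 14 -> j < 14 -> tperm (nm i) (nm j) z = z.
  by move=> hi hj; apply: tpermD; apply: contraNneq h => <-; apply: mem_nth.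
by rewrite /sigma (D 3 10) // (D 1 8) // (D 2 9) // (D 0 11) // (D 7 10) // (D 12 9) //
  (D 6 12) // (D 5 8) // (D 13 11) // (D 4 13) // (D 0 2).
Qed.

Lemma psi_out z : z \notin surgery_darts -> psi z = pp z.
Proof. move=> /sigma_out E; exact: etrans (psiE z) (congr1 (fun_of_perm pp) E). Qed.

Lemma sigma_nm : ((sigma (nm 0) = nm 4) * (sigma (nm 1) = nm 5) * (sigma (nm 2) = nm 6) *
  (sigma (nm 3) = nm 7) * (sigma (nm 8) = nm 1) * (sigma (nm 9) = nm 0) *
  (sigma (nm 10) = nm 3) * (sigma (nm 11) = nm 2))%type.
Proof. by rewrite /sigma !tperm_nm. Qed.

(** When [s (nm j) = nm i], composing with their transposition splits off [nm i] as a fixed point.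
    The order matters for the edge between the hubs: [nm 4] must be split off before its predecessor
    [nm 13], and [nm 6] before [nm 12]. *)
Lemma card_porbits_surgery : #|porbits pp| + 3 <= #|porbits psi|.
Proof.
have N i j : i < 14 -> j < 14 -> i != j -> nm i != nm j.
  by move=> hi hj; rewrite (nth_uniq _ _ _ uniq_surgery_darts).
have split (s : {perm Z}) i j : i < 14 -> j < 14 -> i != j -> s (nm j) = nm i ->
    #|porbits (tperm (nm i) (nm j) * s)| = #|porbits s|.+1.
  by move=> hi hj ij E; apply: porbits_tperm_split; rewrite ?N // -E porbit_step.
(* This split is possible because one face runs along both [(a, b)] and [(c, d)]. *)
have e1 : #|porbits s1| = #|porbits pp|.+1.
  apply: porbits_tperm_split; first exact: N.
  rewrite porbit_sym /nm /= porbit_suml imset_f // /phi porbit_face //; exact: (ds_ab DS).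
have e2 : #|porbits s2| = #|porbits s1|.+1.
  apply: split => //; rewrite 1!permM.
  apply: (etrans (congr1 (fun_of_perm pp) (_ : _ = nm 13)) _); last by rewrite pp_nm.
  by rewrite !tperm_nm.
have e3 : #|porbits s3| = #|porbits s2|.+1.
  apply: split => //; rewrite 2!permM.
  apply: (etrans (congr1 (fun_of_perm pp) (_ : _ = nm 11)) _); last by rewrite pp_nm.
  by rewrite !tperm_nm.
have e4 : #|porbits s4| = #|porbits s3|.+1.
  apply: split => //; rewrite 3!permM.
  apply: (etrans (congr1 (fun_of_perm pp) (_ : _ = nm 8)) _); last by rewrite pp_nm.
  by rewrite !tperm_nm.
have e5 : #|porbits s5| = #|porbits s4|.+1.
  apply: split => //; rewrite 4!permM.
  apply: (etrans (congr1 (fun_of_perm pp) (_ : _ = nm 12)) _); last by rewrite pp_nm.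
  by rewrite !tperm_nm.
have e6 : #|porbits s6| = #|porbits s5|.+1.
  apply: split => //; rewrite 5!permM.
  apply: (etrans (congr1 (fun_of_perm pp) (_ : _ = nm 9)) _); last by rewrite pp_nm.
  by rewrite !tperm_nm.
have e7 : #|porbits s7| = #|porbits s6|.+1.
  apply: split => //; rewrite 6!permM.
  apply: (etrans (congr1 (fun_of_perm pp) (_ : _ = nm 10)) _); last by rewrite pp_nm.
  by rewrite !tperm_nm.
have e8 : _ <= #|porbits s8|.+1 := porbits_tperm_ge s7 (nm 0) (nm 11).
have e9 : _ <= #|porbits s9|.+1 := porbits_tperm_ge s8 (nm 2) (nm 9).
have e10 : _ <= #|porbits s10|.+1 := porbits_tperm_ge s9 (nm 1) (nm 8).
have e11 : _ <= #|porbits psi|.+1 := porbits_tperm_ge s10 (nm 3) (nm 10).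
rewrite e7 e6 e5 e4 e3 e2 e1 in e8.
move: e8 e9 e10 e11; clear; lia.
Qed.

(** A face that followed the removed edge out of [u] now crosses to [prt u] and goes on as if it had
    come from the hub. The crossing back goes on as if it had come from [mate u]. *)
Lemma psi_portL u : u \in ports -> psi (inl (u, mate u)) = pp (inr (hub u, prt u)).
Proof.
case/portsP=> ->; rewrite /mate /hub /prt; do ?rewrite !(eqxx, pE) /=.
- by apply: (etrans (psiE (nm 0))); apply: (congr1 (fun_of_perm pp)); rewrite sigma_nm.
- by apply: (etrans (psiE (nm 1))); apply: (congr1 (fun_of_perm pp)); rewrite sigma_nm.
- by apply: (etrans (psiE (nm 2))); apply: (congr1 (fun_of_perm pp)); rewrite sigma_nm.
- by apply: (etrans (psiE (nm 3))); apply: (congr1 (fun_of_perm pp)); rewrite sigma_nm.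
Qed.

Lemma psi_portR u : u \in ports -> psi (inr (prt u, hub u)) = pp (inl (mate u, u)).
Proof.
case/portsP=> ->; rewrite /mate /hub /prt; do ?rewrite !(eqxx, pE) /=.
- by apply: (etrans (psiE (nm 8))); apply: (congr1 (fun_of_perm pp)); rewrite sigma_nm.
- by apply: (etrans (psiE (nm 9))); apply: (congr1 (fun_of_perm pp)); rewrite sigma_nm.
- by apply: (etrans (psiE (nm 10))); apply: (congr1 (fun_of_perm pp)); rewrite sigma_nm.
- by apply: (etrans (psiE (nm 11))); apply: (congr1 (fun_of_perm pp)); rewrite sigma_nm.
Qed.

(* A dart of the dot product is named by its tail and by the dart of [H] or [H']
   that it replaces; the darts of [H'] leaving [x] or [y] name nothing. *)
Definition kept (z : Z) :=
  match z with
  | inl (u, w) => H u w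
  | inr (v, w) => H' v w && ~~ ((v == x) || (v == y))
  end.

Definition theta (z : Z) : (T + U) * (T + U) :=
  match z with
  | inl (u, w) => (inl u, nbL u w)
  | inr (v, w) => (inr (inner v), nbR (inner v) w)
  end.

Lemma inner_prt u : inner (prt u) = port u.
Proof. by apply: val_inj; rewrite innerK //= -[LHS]negbK negb_or prt_inner. Qed.

Lemma theta_dart z : kept z -> theta z \in darts G.
Proof.
case: z => -[u w] /=; rewrite inE /=; first exact: nbL_nbhd.
by case/andP=> h /negbTE n; apply: nbR_nbhd; rewrite innerK.
Qed.

Lemma theta_inj : {in kept &, injective theta}.
Proof.
move=> [[u w]|[u w]] [[u' w']|[u' w']]; rewrite /in_mem //=.
  by move=> h h' [Eu E]; subst u'; congr (inl (_, _)); rewrite -(nbLK h) E nbLK.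
case/andP=> h /negbTE n /andP[h' /negbTE n'] [E].
have Eu : u = u' by rewrite -(innerK n) E innerK.
by subst u' => Ew; congr (inr (_, _)); rewrite -(@nbRK (inner u) w) ?Ew ?nbRK ?innerK.
Qed.

Lemma theta_psi z : kept z -> kept (psi z) /\ theta (psi z) = face_perm rhoG (theta z).
Proof.
case: z => -[u w].
  move=> /= h; case: (boolP (J u w)) => [j|/(J_mate h)[pu ->]].
    rewrite psi_out.
      rewrite ppL // /nbL j; by split=> //=; apply: (rot_nbr rs); rewrite symH.
    apply/negP=> hn; have [pu E] : u \in ports /\ w = mate u.
      move: hn; rewrite !inE /= => /or4P[/eqP[-> ->]|/eqP[-> ->]|/eqP[-> ->]|].
      - by rewrite /mate !(eqxx, pE).
      - by rewrite /mate !(eqxx, pE).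
      - by rewrite /mate !(eqxx, pE).
      - by case/orP=> // /eqP[-> ->]; rewrite /mate !(eqxx, pE).
    by move: j; rewrite E J_mateF.
  rewrite psi_portL // ppR ?hub_prt // /face_perm /theta nbL_mate // inner_prt /= prtK //.
  rewrite negb_or prt_inner andbT; split=> //.
  by apply: (rot_nbr rs'); apply: prt_hub.
move=> /= /andP[h n]; case wxy: ((w == x) || (w == y)); last first.
  rewrite psi_out.
    have iu := innerK (negbTE n); have iw := innerK wxy.
    have nb : nbR (inner u) w = inr (inner w) by rewrite /nbR wxy.
    rewrite ppR // /theta /face_perm /fst /snd nb /rhoG /backR iu iw /= wxy; split=> //.
    by rewrite andbT; apply: (rot_nbr rs'); rewrite symH'.
  have inrE p q : ((inr p : Z) == inr q) = (p == q) by [].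
  rewrite !inE /= !inrE !xpair_eqE.
  move/norP: n => [/negPf n1 /negPf n2]; move/negbT: wxy => /norP[/negPf n3 /negPf n4].
  by rewrite n1 n2 n3 n4 !andbF.
have [ux uy] := norP n; have [k [pk -> ->]] := nbr_hub ux uy wxy (etrans (symH' _ _) h).
rewrite psi_portR // ppL ?(symH _ k) ?H_mate //= inner_prt nbR_hub //.
by split=> //; apply: (rot_nbr rs); apply: H_mate.
Qed.

Lemma face_theta z n : kept z ->
  kept (iter n psi z) /\ theta (iter n psi z) = iter n (face_perm rhoG) (theta z).
Proof.
move=> k; elim: n => // n [IHk IHe]; have [k' E] := theta_psi IHk.
by rewrite !iterS; split=> //; rewrite E IHe.
Qed.

(** [theta] carries [psi] to the face permutation, so each orbit of a kept dart is the preimage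
    under [theta] of a face. *)
Lemma card_porbits_kept : #|porbit psi @: [set z | kept z]| <= #|faces G rhoG|.
Proof.
pose h (F : {set (T + U) * (T + U)}) := [set w | kept w && (theta w \in F)].
apply: leq_trans (leq_imset_card h _); apply: subset_leq_card.
apply/subsetP=> A /imsetP[z]; rewrite inE => kz ->; apply/imsetP.
exists (face_of rhoG (theta z)); first by rewrite imset_f // theta_dart.
apply/setP=> w; rewrite !inE; apply/porbitP/andP => [[n ->]|[kw /iter_findex E]].
  have [k E] := face_theta n kz; rewrite permX_iter k E; split=> //.
  exact: fconnect_iter.
exists (findex (face_perm rhoG) (theta z) (theta w)); rewrite permX_iter.
have [k E'] := face_theta (findex (face_perm rhoG) (theta z) (theta w)) kz.
by apply: theta_inj => //; rewrite E' E.
Qed.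

(** The 6 stands for the three darts leaving each of [x] and [y]. *)
Lemma card_not_kept : #|~: [set z | kept z]| <= #|~: darts H| + #|~: darts H'| + 6.
Proof.
pose D6 := [:: (x, a'); (x, b'); (x, y); (y, c'); (y, d'); (y, x)].
have iL : injective (@inl (T * T) (T' * T')) by move=> ? ? [].
have iR : injective (@inr (T * T) (T' * T')) by move=> ? ? [].
have sub : ~: [set z | kept z] \subset
    (inl @: ~: darts H) :|: (inr @: ~: darts H') :|: [set z in map inr D6].
  apply/subsetP=> -[[u w]|[u w]]; rewrite !inE.
    move=> h; apply/orP; left; apply/orP; left.
    by apply/imsetP; exists (u, w); rewrite ?inE.
  move=> /=; rewrite negb_and negbK => h; case: (boolP (H' u w)) h => [h /= uxy|h _]; last first.
    by apply/orP; left; apply/orP; right; apply/imsetP; exists (u, w); rewrite ?inE.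
  have inrE p q : ((inr p : Z) == inr q) = (p == q) by [].
  apply/orP; right; rewrite !inrE !xpair_eqE.
  by case/orP: uxy h => /eqP->; rewrite ?nbr_x ?nbr_y !inE => /or3P[] /eqP->; rewrite !eqxx ?orbT.
apply: leq_trans (subset_leq_card sub) _.
apply: leq_trans (leq_card_setU _ _).1 _; apply: leq_add.
  apply: leq_trans (leq_card_setU _ _).1 _.
  by rewrite !card_imset.
by rewrite cardsE card_size.
Qed.

(** The non-darts of [H] and [H'] occur on both sides and cancel. The 3 is the six discarded darts
    less the three cycles gained by the surgery. *)
Lemma card_faces_dot : #|faces H rho| + #|faces H' rho'| <= #|faces G rhoG| + 3.
Proof.
have cpp := card_porbits_sum phi phi'; rewrite !card_porbits_face in cpp.
have surg := card_porbits_surgery.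
have k1 := card_porbits_kept; have k2 := card_not_kept.
have k3 : #|porbits psi| <= #|porbit psi @: [set z | kept z]| + #|~: [set z | kept z]|.
  apply: leq_trans (leq_add (leqnn _) (leq_imset_card (porbit psi) _)).
  apply: leq_trans (leq_card_setU _ _).1; rewrite -imsetU setUCr.
  by apply: subset_leq_card; apply/subsetP=> A /imsetP[z _ ->]; rewrite imset_f ?inE.
have {}surg := leq_trans surg k3; rewrite /pp cpp in surg.
move: surg k1 k2; clear; do 7!move: (#|_|) => ?; lia.
Qed.

Lemma plane_dot : 6 <= #|T| -> 6 <= #|T'| -> (forall u v, connect H u v) ->
  (forall u v, connect H' u v) -> (forall u v, connect G u v) ->
  plane_rotation H rho -> plane_rotation H' rho' -> plane_rotation G rhoG.
Proof.
move=> T6 T6' cH cH' cG.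
have cardG : #|{: T + U}| + 2 = #|T| + #|T'|.
  rewrite card_sum -addnA; congr (_ + _).
  rewrite card_sig -(cardC [pred v | (v != x) && (v != y)]); congr (_ + _).
  rewrite -(_ : #|[set x; y]| = 2); last by rewrite cards2 xE.
  by apply: eq_card => v; rewrite !inE negb_and !negbK.
have G0 : 0 < #|{: T + U}| by move: cardG T6; do 3!move: (#|_|) => ?; lia.
have T0 : 0 < #|T| by apply: leq_trans T6.
have T0' : 0 < #|T'| by apply: leq_trans T6'.
case/(plane_cubicE _ (ds_cub DS) T0 cH)=> _ f1; case/(plane_cubicE _ (ds_cub' DS) T0' cH')=> _ f2.
apply/(plane_cubicE _ dot_cubic G0 cG); split; first exact: rotation_system_dot.
have nbG v : exists w, G v w.
  have /card_gt0P[w] : 0 < #|nbhd G v| by rewrite dot_cubic.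
  by rewrite inE; exists w.
(* With [N] vertices and [3N] darts, Euler's inequality bounds twice the number of faces above by
   [N + 4], and [card_faces_dot] bounds it below by the same number. *)
have := euler_inequality dot_simple rotation_system_dot nbG cG.
rewrite (card_darts dot_cubic); move: card_faces_dot cardG f1 f2 T6 T6'; clear.
by do 6!move: (#|_|) => ?; lia.
Qed.

End Planarity.

Lemma del2_sym : symmetric J.
Proof. by move=> u v; apply: (dot_sym (inl u) (inl v)). Qed.

Lemma dot_hypohamiltonian : 6 <= #|T| -> 6 <= #|T'| ->
  ~ hamiltonian H -> hypohamiltonian H' ->
  good_pair J [set: T] a c -> good_pair J [set: T] a d ->
  good_pair J [set: T] b c -> good_pair J [set: T] b d ->
  good_pairs J [set: T] a b c d ->
  (forall t, good_pair J [set~ t] a b \/ good_pair J [set~ t] c d) ->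
  hypohamiltonian G.
Proof.
move=> T6 T6' nH hyp gac gad gbc gbd gabcd gt.
have sJ := good_pair_sym del2_sym; have sJ2 := good_pairs_symr del2_sym.
split; first by apply: dot_not_hamiltonian => //; case: hyp.
case=> [t|v].
  have [ma mc] : mate a = b /\ mate c = d by rewrite /mate !(eqxx, pE).
  have [pa pc] : a \in ports /\ c \in ports by rewrite !inE !eqxx ?orbT.
  by case: (gt t) => g; [apply: (hamiltonian_minus_left T6 hyp pa); rewrite ma
                        |apply: (hamiltonian_minus_left T6 hyp pc); rewrite mc].
apply: hamiltonian_minus_right => //.
  move=> u w /portsP[] -> /portsP[] ->; rewrite /hub !(eqxx, pE) //= => _; try by [];
  by apply: sJ.
have gba : good_pairs J [set: T] b a c d by apply/good_pairsC/sJ2/good_pairsC.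
move=> u w /portsP[] -> /portsP[] ->; rewrite /hub /mate; do ?rewrite !(eqxx, pE) //=; move=> _;
 by [|apply: sJ2|apply: good_pairsC|apply/sJ2/good_pairsC|apply/good_pairsC/sJ2
     |apply/sJ2/good_pairsC/sJ2].
Qed.

End Dot.

(** * Exchanging the ends of a removed edge *)

Section Relabel.
Variables (T T' : finType) (H : rel T) (H' : rel T').
Variables (a b c d : T) (x y a' b' c' d' : T').

(** The graph does not change when the ends of [ab] are exchanged together with their attachment
    vertices. A face that runs from [b] to [a] is thus treated by exchanging the labels [a'] and
    [b']. *)
Lemma dot_swapl :
  dot H H' b a c d x y b' a' c' d' =2 dot H H' a b c d x y a' b' c' d'.
Proof.
move=> [u|u] [v|v] //=; rewrite /dot_attach /del2 /same_edge.
- by rewrite [in LHS](orbC ((u == b) && _)).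
- by rewrite orbCA.
- by rewrite orbCA.
Qed.

Lemma dot_swapr :
  dot H H' a b d c x y a' b' d' c' =2 dot H H' a b c d x y a' b' c' d'.
Proof.
move=> [u|u] [v|v] //=; rewrite /dot_attach /del2 /same_edge.
- by rewrite [in LHS](orbC ((u == d) && _)).
- by rewrite [in LHS](orbC ((u == d) && _)).
- by rewrite [in LHS](orbC ((v == d) && _)).
Qed.

Hypothesis DS : dot_setup H H' a b c d x y a' b' c' d'.

Lemma dot_setup_swapl : dot_setup H H' b a c d x y a' b' c' d'.
Proof.
case: DS => [[s i] sg' ? ? ? ? U ? ? ? ? ? ?]; split=> //; first by rewrite s.
by rewrite (perm_uniq (permEl (perm_catCA [:: b] [:: a] [:: c; d]))).
Qed.

Lemma dot_setup_swapr : dot_setup H H' a b d c x y a' b' c' d'.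
Proof.
case: DS => [[s i] sg' ? ? ? ? U ? ? ? ? ? ?]; split=> //; first by rewrite s.
have P : perm_eq [:: a; b; d; c] [:: a; b; c; d].
  by rewrite (perm_cat2l [:: a; b] [:: d; c] [:: c; d]) (perm_catC [:: d] [:: c]).
by rewrite (perm_uniq P).
Qed.

Lemma dot_setup_swapl' : dot_setup H H' a b c d x y b' a' c' d'.
Proof.
have P : perm_eq [:: x; y; b'; a'; c'; d'] [:: x; y; a'; b'; c'; d'].
  by rewrite (perm_cat2l [:: x; y] [:: b', a' & _] [:: a', b' & _]) (perm_catCA [:: b'] [:: a']).
by case: DS => *; split=> //; rewrite (perm_uniq P).
Qed.

Lemma dot_setup_swapr' : dot_setup H H' a b c d x y a' b' d' c'.
Proof.
have P : perm_eq [:: x; y; a'; b'; d'; c'] [:: x; y; a'; b'; c'; d'].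
  by rewrite (perm_cat2l [:: x; y; a'; b'] [:: d'; c'] [:: c'; d']) (perm_catC [:: d'] [:: c']).
by case: DS => *; split=> //; rewrite (perm_uniq P).
Qed.

End Relabel.

Theorem theorem2p1 (T T' : finType) (H : rel T) (H' : rel T')
    (a b c d : T) (x y a' b' c' d' : T') :
  simple_graph H -> simple_graph H' -> cubic H -> cubic H' ->
  6 <= #|T| -> 6 <= #|T'| ->
  ~ hamiltonian H -> hypohamiltonian H' ->
  H a b -> H c d -> [&& a != c, a != d, b != c & b != d] ->
  good_pair (del2 H a b c d) [set: T] a c ->
  good_pair (del2 H a b c d) [set: T] a d ->
  good_pair (del2 H a b c d) [set: T] b c ->
  good_pair (del2 H a b c d) [set: T] b d ->
  good_pairs (del2 H a b c d) [set: T] a b c d ->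
  (forall t : T, good_pair (del2 H a b c d) [set~ t] a b \/
                 good_pair (del2 H a b c d) [set~ t] c d) ->
  H' x y ->
  H' x a' -> H' x b' -> a' != b' -> a' != y -> b' != y ->
  H' y c' -> H' y d' -> c' != d' -> c' != x -> d' != x ->
  [/\ simple_graph (dot H H' a b c d x y a' b' c' d'),
      cubic (dot H H' a b c d x y a' b' c' d'),
      hypohamiltonian (dot H H' a b c d x y a' b' c' d'),
      (planar H' ->
       (exists rho, plane_rotation H rho /\
          exists p, p \in darts H /\
            ((a, b) \in face_of rho p \/ (b, a) \in face_of rho p) /\
            ((c, d) \in face_of rho p \/ (d, c) \in face_of rho p)) ->
       exists a2 b2 c2 d2 : T',
         [/\ [set a2; b2] = [set a'; b'], [set c2; d2] = [set c'; d']
           & planar (dot H H' a b c d x y a2 b2 c2 d2)])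
    & forall g g' : nat, is_girth H g -> is_girth H' g' ->
        forall s, is_cycle (dot H H' a b c d x y a' b' c' d') s ->
          minn g g' <= size s].
Proof.
move=> sg sg' cub cub' T6 T6' nH hyp Hab Hcd /and4P[ac ad bc bd].
move=> gac gad gbc gbd gabcd gt xy xa xb ab' ay by' yc yd cd' cx dx.
have neq (V : finType) (e : rel V) u v : simple_graph e -> e u v -> u != v.
  by move=> [_ ei]; apply: contraTneq => ->; rewrite ei.
have tri v : H' x v -> H' y v -> False.
  move=> xv yv; apply: (@hypohamiltonian_no_triangle _ H' x v y) => //.
    by rewrite (sg'.1 v).
  by rewrite (sg'.1 y).
have tri2 u v : H' x u -> H' y v -> u != v.
  by move=> xu yv; apply/eqP=> E; subst v; apply: tri xu yv.
have DS : dot_setup H H' a b c d x y a' b' c' d'.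
  split=> //.
    by rewrite /= !inE !negb_or ac ad bc bd (neq _ _ _ _ sg Hab) (neq _ _ _ _ sg Hcd).
  have N u v : H' u v -> u != v by apply: neq.
  rewrite /= !inE !negb_or ab' cd' (tri2 _ _ xa yc) (tri2 _ _ xa yd) (tri2 _ _ xb yc)
    (tri2 _ _ xb yd) (N _ _ xy) (N _ _ xa) (N _ _ xb) (N _ _ yc) (N _ _ yd).
  by rewrite ![x == _]eq_sym ![y == _]eq_sym ay by' cx dx.
have hypD a2 b2 c2 d2 : dot_setup H H' a b c d x y a2 b2 c2 d2 ->
    hypohamiltonian (dot H H' a b c d x y a2 b2 c2 d2).
  by move=> DS2; apply: dot_hypohamiltonian.
split.
- exact: dot_simple DS.
- exact: dot_cubic DS.
- exact: hypD.
- move=> [rho' pl'] [rho [pl [p [pd [fab fcd]]]]].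
  have rs := pl.1; have rs' := pl'.1.
  (* A hamiltonian path of [J] already connects [H]. *)
  have connH u v : connect H u v.
    have [s [W _ M]] := (good_pairP _ _ _ _).1 gac.
    have{W} /walkP[s' [Es P _]] := sub_walk (@J_sub _ H a b c d) W.
    have con w : connect H a w.
      by apply: (path_connect P); rewrite -Es M inE.
    by apply: connect_trans (con v); rewrite (sym_connect_sym sg.1).
  have T3' : 2 < #|T'| by apply: leq_trans T6'.
  have connH' := hypohamiltonian_connected T3' hyp.
  (* Indices 1 and 2 name the graph in the orientation that the gluing requires; index 3 is the
     labelling with [ab] and [cd] in their given direction, as the conclusion demands. *)
  have core (a1 b1 c1 d1 : T) (a2 b2 c2 d2 a3 b3 c3 d3 : T') :
      dot_setup H H' a1 b1 c1 d1 x y a2 b2 c2 d2 ->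
      dot_setup H H' a b c d x y a3 b3 c3 d3 ->
      dot H H' a1 b1 c1 d1 x y a2 b2 c2 d2 =2 dot H H' a b c d x y a3 b3 c3 d3 ->
      [/\ rho' x y = a2, rho' x a2 = b2 & rho' x b2 = y] ->
      [/\ rho' y x = c2, rho' y c2 = d2 & rho' y d2 = x] ->
      (a1, b1) \in face_of rho p -> (c1, d1) \in face_of rho p ->
      planar (dot H H' a b c d x y a3 b3 c3 d3).
    move=> DS1 DS3 E [x1 x2 x3] [y1 y2 y3] f1 f2; apply: (eq_planar E).
    have ab1 : (a1, b1) \in darts H by rewrite inE (ds_ab DS1).
    have f12 := face_of_trans sg rs pd ab1 f1 f2.
    exists (rhoG DS1 rho rho'); apply: plane_dot => //.
    move=> u v; rewrite (eq_connect E).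
    apply: hypohamiltonian_connected (hypD _ _ _ _ DS3) u v.
    by rewrite card_sum; apply: leq_trans (leq_addr _ _); apply: leq_trans T6.
  (* These labels are dictated by the rotations of [H'] alone. Each of [ab], [cd] that the common
     face traverses backwards then exchanges its pair of labels once more. *)
  have [a2 [b2 [c2 [d2 [Eab Ecd DS2 rx ry]]]]] : exists a2 b2 c2 d2,
      [/\ [set a2; b2] = [set a'; b'], [set c2; d2] = [set c'; d'],
          dot_setup H H' a b c d x y a2 b2 c2 d2,
          [/\ rho' x y = a2, rho' x a2 = b2 & rho' x b2 = y] &
          [/\ rho' y x = c2, rho' y c2 = d2 & rho' y d2 = x]].
    have Ux : uniq [:: y; a'; b'].
      by rewrite /= !inE negb_or ab' ![y == _]eq_sym ay by'.
    have Uy : uniq [:: x; c'; d'].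
      by rewrite /= !inE negb_or cd' ![x == _]eq_sym cx dx.
    case: (rotation3 rs' (nbr_x DS) Ux) => rx; case: (rotation3 rs' (nbr_y DS) Uy) => ry.
    - by exists a', b', c', d'.
    - exists a', b', d', c'; split=> //; first by rewrite setUC.
      exact: dot_setup_swapr'.
    - exists b', a', c', d'; split=> //; first by rewrite setUC.
      exact: dot_setup_swapl'.
    - exists b', a', d', c'; split=> //; try by rewrite setUC.
      exact/dot_setup_swapr'/dot_setup_swapl'.
  case: fab => fab; case: fcd => fcd.
  + exists a2, b2, c2, d2; split=> //.
    exact: (core a b c d a2 b2 c2 d2).
  + exists a2, b2, d2, c2; split=> //; first by rewrite setUC.
    apply: (core a b d c a2 b2 c2 d2) => //; first exact: dot_setup_swapr.
      exact: dot_setup_swapr'.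
    exact: dot_swapr.
  + exists b2, a2, c2, d2; split=> //; first by rewrite setUC.
    apply: (core b a c d a2 b2 c2 d2) => //; first exact: dot_setup_swapl.
      exact: dot_setup_swapl'.
    exact: dot_swapl.
  + exists b2, a2, d2, c2; split=> //; try by rewrite setUC.
    apply: (core b a d c a2 b2 c2 d2) => //; first exact/dot_setup_swapr/dot_setup_swapl.
      exact/dot_setup_swapr'/dot_setup_swapl'.
    by move=> u v; rewrite dot_swapl dot_swapr.
- by move=> g g' hg hg' s; apply: (girth_dot DS hg hg').
Qed.
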